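(* Let $G$ be a word-hyperbolic group and let $H$ be a finitely generated subgroup of $G$. Then the Frattini subgroup $F(H)$ of $H$ is finite.
   Context: For a group $H$, the Frattini subgroup $F(H)$ is defined as the intersection of all maximal subgroups of $H$, provided at least one maximal subgroup exists, and as $F(H) := H$ otherwise. (A maximal subgroup is a proper subgroup not contained in any strictly larger proper subgroup.) A word-hyperbolic group is a finitely generated group whose Cayley graph with respect to a finite generating set is $\delta$-hyperbolic for some $\delta \geq 0$, that is, for any geodesic triangle each side is contained in the closed $\delta$-neighborhood of the union of the other two sides. *)

(* Defs.v *)
From HB Require Import structures.
From mathcomp Require Import all_boot all_order all_algebra.
From mathcomp Require Import all_classical reals.

Set Implicit Arguments.
Unset Strict Implicit.
Unset Printing Implicit Defensive.

Import Order.TTheory GRing.Theory Num.Theory.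

Local Open Scope classical_set_scope.
Local Open Scope ring_scope.

Section Subgroups.
Context {G : groupType}.
Implicit Types (H K M S : set G).

Definition subgroup : set (set G) := [set K | group_closed [in K]].

Definition generated S : set G := smallest subgroup S.

Definition finitely_generated H : Prop :=
  exists S, finite_set S /\ generated S = H.

Definition proper_subgroup K H : Prop := subgroup K /\ K `<` H.

Definition maximal_subgroup M H : Prop :=
  proper_subgroup M H /\ forall K, proper_subgroup K H -> ~ (M `<` K).

Definition Frattini H : set G :=
  if `[< exists M, maximal_subgroup M H >]
  then \bigcap_(M in [set M | maximal_subgroup M H]) M
  else H.

End Subgroups.

(* A space is a carrier set D of points of X with a distance d on D. *)
Section Hyperbolicity.
Context {R : realType} {X : Type}.
Variables (D : set X) (d : X -> X -> R).

Definition geodesic (gamma : R -> X) (L : R) (x y : X) : Prop :=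
  [/\ 0 <= L, gamma 0 = x, gamma L = y,
      forall s, 0 <= s <= L -> D (gamma s) &
      forall s t, 0 <= s <= L -> 0 <= t <= L ->
        d (gamma s) (gamma t) = `|s - t|].

Definition geodesic_segment (A : set X) (x y : X) : Prop :=
  exists (gamma : R -> X) (L : R),
    geodesic gamma L x y /\ A = gamma @` [set s | 0 <= s <= L].

(* Only applied to unions of geodesic segments, which are compact, so that
   asking for a point of A at distance at most e is the same as asking for the
   distance to A to be at most e. *)
Definition closed_neighborhood (e : R) (A : set X) : set X :=
  [set p | D p /\ exists2 q, A q & d p q <= e].

Definition delta_hyperbolic (delta : R) : Prop :=
  forall (x y z : X) (A B C : set X),
    geodesic_segment A x y -> geodesic_segment B y z ->
    geodesic_segment C z x ->
    [/\ A `<=` closed_neighborhood delta (B `|` C),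
        B `<=` closed_neighborhood delta (C `|` A) &
        C `<=` closed_neighborhood delta (A `|` B)].

End Hyperbolicity.

Section CayleyGraph.
Context {R : realType} {G : groupType}.
Variable S : set G.

(* Points of the geometric realization of the Cayley graph, which has vertex
   set G and one edge of length 1 from g to g * s for all g in G and s in S:
   Edge_point g s t is the point of that edge at distance t from g. The
   condition 0 < t < 1 below makes the representation of points unique. *)
Inductive cayley_point : Type :=
| Vertex of G
| Edge_point of G & G & R.

Definition cayley_graph : set cayley_point :=
  [set p | if p is Edge_point _ s t then S s /\ 0 < t < 1 else True].

(* The lengths of the edge paths from g to h: such a path reads off a word in
   the elements of S and their inverses, with product g^-1 * h. *)
Definition edge_path_lengths (g h : G) : set nat :=
  [set size w | w in [set w : seq G |
     (forall x, x \in w -> S x \/ S x^-1%g) /\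
     (g * foldr (fun x y => x * y) 1 w)%g = h]].

(* The pairs (v, c) such that v is an end of the edge containing p, at
   distance c from p along that edge. *)
Definition exits (p : cayley_point) : set (G * R) :=
  match p with
  | Vertex g => [set (g, 0)]
  | Edge_point g s t => [set (g, t); ((g * s)%g, 1 - t)]
  end.

(* The lengths of the paths from p to q that leave p and reach q through
   vertices. *)
Definition lengths_through_vertices (p q : cayley_point) : set R :=
  [set c | exists a b n,
     [/\ exits p a, exits q b, edge_path_lengths a.1 b.1 n &
         c = a.2 + n%:R + b.2]].

Definition lengths_inside_edge (p q : cayley_point) : set R :=
  [set c | exists g s t r,
     [/\ p = Edge_point g s t, q = Edge_point g s r & c = `|t - r|]].

Definition cayley_dist (p q : cayley_point) : R :=
  inf (lengths_through_vertices p q `|` lengths_inside_edge p q).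

End CayleyGraph.

Definition word_hyperbolic (R : realType) (G : groupType) : Prop :=
  exists S : set G,
    [/\ finite_set S, generated S = setT &
        exists2 delta : R, 0 <= delta &
          delta_hyperbolic (cayley_graph S) (cayley_dist S) delta].

(* Main.v *)
Require Import Defs.
From HB Require Import structures.
From mathcomp Require Import all_boot all_order all_algebra.
From mathcomp Require Import all_classical reals.
From mathcomp Require Import zify lra.

(** The elements of a Frattini subgroup are non-generators: if H is finitely
    generated and K is a proper subgroup of H, then by Zorn's lemma K lies in a
    maximal subgroup, which also contains F = Frattini H
    ([Frattini_nongenerators]). So F is finite as soon as an infinite F allows
    one to build a proper subgroup K of H which generates H together with F.

    The geometry takes place in the word length l of G. Since G is hyperbolic,
    l satisfies Gromov's four-point inequality up to an additive constant D
    ([word_hyperbolic_length]): in a thin triangle, some vertex of the side xy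
    is close to both other sides, and comparing these vertices for the
    triangles xyz and xyt gives the inequality for x, y, z, t. Together with the
    finiteness of balls and the divisibility of lengths this is all that is used
    afterwards ([hyperbolic_length]); every estimate is linear arithmetic over
    instances of the four-point inequality.

    An infinite F contains a loxodromic element v, one whose powers form a
    quasi-geodesic ([infinite_subgroup_loxodromic]). The construction of K
    depends on the commensurator E of v, the elements that conjugate some
    power of v to itself or to its inverse.

    If H is contained in E, then some power z of v generates a normal subgroup
    of H ([commensurator_uniform]), of finite index because each of its cosets
    contains an element of bounded length ([preserving_coset_bounded]). If q is
    the index, the transfer is a crossed homomorphism from H to the integers
    which maps z to q, and the elements with transfer divisible by q + 1 form a
    subgroup K that misses z but meets every coset of the group generated by z
    ([normal_cyclic_supplement]).

    Otherwise, H contains some k outside E, and u = k v k^-1 is another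
    element of F. After multiplying some of the generators h_i of H by u, none
    of them lies in E, so that v^n h_i v^m is about as long as v^n and v^m
    together ([independence]), and the same holds for u^c in place of h_i,
    c <> 0. Hence the elements u^(2i) v^M h_i v^M u^-(2i+1) play ping-pong for
    large M: all non-trivial elements of the subgroup K that they generate are
    longer than the generators of H ([ping_pong_subgroup]). So K is proper,
    although K and F together generate H. *)

Set Implicit Arguments.
Unset Strict Implicit.
Unset Printing Implicit Defensive.

Import Order.TTheory GRing.Theory Num.Theory.

Local Open Scope classical_set_scope.

(** * Integer powers and subgroups *)

(** The structures in which lemmas state products, inverses and powers reach
    groups along several inheritance paths, convertible but not syntactically
    equal; they are unified here so that lia sees equal lengths as one atom. *)
Ltac unify_op op M0 :=
  repeat match goal with
  | |- context [op ?M] =>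
      lazymatch M with M0 => fail | _ => change M with M0 in * end
  | _ : context [op ?M] |- _ =>
      lazymatch M with M0 => fail | _ => change M with M0 in * end
  end.

Ltac group_lia :=
  try match goal with G : groupType |- _ =>
    unify_op @monoid.mul (monoid_Group__to__monoid_Magma G);
    unify_op @natexp (monoid_Group__to__monoid_BaseUMagma G);
    unify_op @monoid.one (monoid_Group__to__monoid_BaseUMagma G);
    unify_op @monoid.inv (monoid_Group__to__monoid_BaseGroup G)
  end; lia.

Section IntegerPowers.
Context {G : groupType}.
Implicit Types (x y : G) (k m : int).

Definition zpow x k : G :=
  match k with Posz n => (x ^+ n)%g | Negz n => (x ^- n.+1)%g end.

Lemma zpowS x k : zpow x (k + 1)%R = (zpow x k * x)%g.
Proof.
case: k => n.
  by rewrite -PoszD addn1 /= expgSr.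
case: n => [|n]; first by rewrite /= expg1 mulVg.
rewrite (_ : (Negz n.+1 + 1)%R = Negz n) ?NegzE; last by lia.
by rewrite /= (expgS x n.+1) invgM mulgVK.
Qed.

Lemma zpow_pred x k : zpow x (k - 1)%R = (zpow x k * x^-1)%g.
Proof. by rewrite -{2}(subrK 1%R k) zpowS mulgK. Qed.

Lemma zpowD x k m : zpow x (k + m)%R = (zpow x k * zpow x m)%g.
Proof.
elim: m => [|n IHn|n IHn]; first by rewrite addr0 mulg1.
  by rewrite -addn1 PoszD addrA !zpowS IHn mulgA.
by rewrite -addn1 PoszD opprD addrA !zpow_pred IHn mulgA.
Qed.

Lemma zpowN x k : zpow x (- k)%R = (zpow x k)^-1%g.
Proof. by apply/esym/mulg1_eq; rewrite -zpowD subrr. Qed.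

Lemma zpowM x k m : zpow x (k * m)%R = zpow (zpow x k) m.
Proof.
elim: m => [|n IHn|n IHn]; first by rewrite mulr0.
  by rewrite -addn1 PoszD mulrDr mulr1 (zpowD x _ k) IHn zpowS.
by rewrite -addn1 PoszD opprD mulrDr mulrN1 (zpowD x) IHn (zpowD (zpow x k)) !zpowN.
Qed.

Lemma zpow_conj x y k : (y * zpow x k * y^-1)%g = zpow (y * x * y^-1)%g k.
Proof.
elim: k => [|n IHn|n IHn]; first by rewrite mulg1 mulgV.
  by rewrite -addn1 PoszD !zpowS -IHn !gnorm.
by rewrite -addn1 PoszD opprD !zpow_pred -IHn !gnorm.
Qed.

End IntegerPowers.

Section Subgroups.
Context {G : groupType}.
Implicit Types (H K S : set G) (x y : G).

Lemma subgroupP H :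
  subgroup H <-> H 1%g /\ (forall x y, H x -> H y -> H (x * y^-1)%g).
Proof.
rewrite /subgroup /group_closed /divg_closed; split=> /= -[H1 HV]; split.
- by rewrite inE in H1.
- by move=> x y Hx Hy; have := HV x y; rewrite !inE; apply.
- by rewrite inE.
- by move=> x y; rewrite !inE; apply: HV.
Qed.

Lemma subgroup1 H : subgroup H -> H 1%g.
Proof. by case/subgroupP. Qed.

Lemma subgroupV H x : subgroup H -> H x -> H x^-1%g.
Proof. by move=> /subgroupP[H1 HV] Hx; rewrite -[(x^-1)%g]mul1g; apply: HV. Qed.

Lemma subgroupM H x y : subgroup H -> H x -> H y -> H (x * y)%g.
Proof.
move=> sgH Hx Hy; rewrite -[y]invgK; case/subgroupP: (sgH) => _; apply=> //.
exact: subgroupV.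
Qed.

Lemma subgroupX H x n : subgroup H -> H x -> H (x ^+ n)%g.
Proof.
move=> sgH Hx; elim: n => [|n IH]; first exact: subgroup1.
by rewrite expgS; apply: subgroupM.
Qed.

Lemma subgroup_zpow H x k : subgroup H -> H x -> H (zpow x k).
Proof.
move=> sgH Hx; case: k => n /=; first exact: subgroupX.
by apply: subgroupV => //; apply: subgroupX.
Qed.

Lemma generated_subgroup S : subgroup (generated S).
Proof.
apply/subgroupP; split=> [A [sgA _]|x y gx gy A AS].
  exact: subgroup1.
by have [/subgroupP[_ HV] _] := AS; apply: HV; [apply: gx | apply: gy].
Qed.

Lemma generated_sub S H : subgroup H -> S `<=` H -> generated S `<=` H.
Proof. exact: smallest_sub. Qed.

Lemma sub_generated S : S `<=` generated S.
Proof. exact: sub_gen_smallest. Qed.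

(** The x such that left translations by x and by its inverse map P into P form
    a subgroup; this spares the consideration of words in S. *)
Lemma generated_translate S (P : set G) :
  P 1%g -> (forall s x, S s -> P x -> P (s * x)%g /\ P (s^-1 * x)%g) ->
  generated S `<=` P.
Proof.
move=> P1 PS; pose Q := [set x | forall y, P y -> P (x * y)%g /\ P (x^-1 * y)%g].
have sgQ : subgroup Q.
  apply/subgroupP; split=> [y Py|x y Qx Qy z Pz]; first by rewrite !gnorm.
  rewrite invgM invgK -!mulgA; split.
    exact: (Qx _ (Qy _ Pz).2).1.
  exact: (Qy _ (Qx _ Pz).2).1.
have SQ : S `<=` Q by move=> s Ss y; apply: PS.
by move=> x /(generated_sub sgQ SQ)/(_ _ P1)[]; rewrite mulg1.
Qed.

End Subgroups.

(** * Lengths with a four-point inequality *)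

Lemma finite_set_repeats (T : eqType) (A : set T) : finite_set A ->
  exists N, forall f : nat -> T, (forall i, i <= N -> A (f i)) ->
    exists i j, i < j <= N /\ f i = f j.
Proof.
move=> /finite_seqP[s ->]; exists (size s) => f fs.
have sz : size (map f (iota 0 (size s).+1)) = (size s).+1.
  by rewrite size_map size_iota.
have : ~~ uniq (map f (iota 0 (size s).+1)).
  apply/negP => /uniq_leq_size H.
  suff : (size s).+1 <= size s by rewrite ltnn.
  rewrite -{1}sz; apply: (H s) => x /mapP[i].
  rewrite mem_iota add0n ltnS => /andP[_ ile] ->.
  exact: fs.
case/(uniqPn (f 0)) => i [j []] ij; rewrite sz => jN.
rewrite !(nth_map 0) ?size_iota ?(ltn_trans ij) // !nth_iota ?(ltn_trans ij) //.
by move=> e; exists i, j; split; rewrite ?ij.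
Qed.

Definition dist (G : groupType) (l : G -> nat) (x y : G) : nat :=
  l (x^-1 * y)%g.

(** The constant D is 2 delta in the usual formulation of the four-point
    condition; the ambient geodesics survive only as [length_split]. *)
Record hyperbolic_length (G : groupType) (l : G -> nat) (D : nat) : Prop := {
  length1 : l 1%g = 0;
  lengthV : forall x, l (x^-1)%g = l x;
  lengthM : forall x y, l (x * y)%g <= l x + l y;
  finite_ball : forall n, finite_set [set x | l x <= n];
  length_split : forall x t, t <= l x ->
    exists p, l p = t /\ l (p^-1 * x)%g = l x - t;
  four_point : forall x y z w,
    dist l x y + dist l z w <=
      maxn (dist l x z + dist l y w) (dist l x w + dist l y z) + D
}.

(** That is, the powers of v form a quasi-geodesic. The condition is invariant
    under conjugation, unlike the inequality between the lengths of v and its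
    square from which it is derived below. *)
Definition loxodromic (G : groupType) (l : G -> nat) (v : G) : Prop := exists C,
  (forall n m, l (v ^+ n)%g + l (v ^+ m)%g <= l (v ^+ (n + m))%g + C) /\
  (forall n, n <= l (v ^+ n)%g + C).

Section Hyperbolic.
Context {G : groupType} {l : G -> nat} {D : nat} (hyp : hyperbolic_length l D).
Implicit Types (x y z w p g h v u : G).

Local Notation d := (dist l).

Lemma dist_sym x y : d x y = d y x.
Proof. by rewrite /dist -(lengthV hyp) invgM invgK. Qed.

Lemma distxx x : d x x = 0.
Proof. by rewrite /dist mulVg (length1 hyp). Qed.

Lemma dist1x x : d 1%g x = l x.
Proof. by rewrite /dist invg1 mul1g. Qed.

Lemma distx1 x : d x 1%g = l x.
Proof. by rewrite dist_sym dist1x. Qed.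

Lemma dist_triangle y x z : d x z <= d x y + d y z.
Proof.
rewrite /dist (_ : x^-1 * z = (x^-1 * y) * (y^-1 * z))%g ?(lengthM hyp) //.
by rewrite !gnorm.
Qed.

Lemma dist_mull g x y : d (g * x)%g (g * y)%g = d x y.
Proof. by rewrite /dist !gnorm. Qed.

Lemma dist_mulr x g : d x (x * g)%g = l g.
Proof. by rewrite /dist mulKg. Qed.

(** A path that makes definite progress at every second step makes progress for
    ever: in the four-point inequality for f 0, f i, f i.+1 and f i.+2, the
    progress made at step i leaves only the alternative in which f i.+2 is
    farther from f 0 than f i.+1. *)
Lemma dist_local_to_global (f : nat -> G) a n : 0 < a ->
  (forall i, i.+1 < n ->
     maxn (d (f i) (f i.+1)) (d (f i.+1) (f i.+2)) + a + D <= d (f i) (f i.+2)) ->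
  forall i, i < n -> 1 < n -> d (f 0) (f i) + a <= d (f 0) (f i.+1).
Proof.
move=> a0 H i + n1; elim: i => [|i IH] lin.
  have := H 0 n1; have := dist_triangle (f 1) (f 0) (f 2); rewrite distxx; lia.
have {}IH := IH (ltnW lin); have := H i lin.
have := four_point hyp (f 0) (f i.+1) (f i) (f i.+2).
by have := dist_sym (f i) (f i.+1); lia.
Qed.

Lemma dist_exp v i n : i <= n -> d (v ^+ i)%g (v ^+ n)%g = l (v ^+ (n - i))%g.
Proof. by move=> /subnKC {1}<-; rewrite expgnDr dist_mulr. Qed.

Lemma dist_expV v i n : d (v ^- i)%g (v ^+ n)%g = l (v ^+ (i + n))%g.
Proof. by rewrite /dist invgK expgnDr. Qed.

(** The distances from the point v^-n to 1 = v^0 and to v^1, and those from v^m,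
    both change by more than D, in opposite directions; so the four-point
    inequality forces the distance from v^-n to v^m to be almost the sum of the
    distances to 1. *)
Lemma loxodromic_square v : l v + 2 * D + 1 <= l (v ^+ 2)%g -> loxodromic l v.
Proof.
move=> H; have grow n : l (v ^+ n)%g + D.+1 <= l (v ^+ n.+1)%g.
  have step i : i.+1 < n.+2 -> maxn (d (v ^+ i)%g (v ^+ i.+1)%g)
      (d (v ^+ i.+1)%g (v ^+ i.+2)%g) + D.+1 + D <= d (v ^+ i)%g (v ^+ i.+2)%g.
    have dD j k : d (v ^+ j)%g (v ^+ (j + k))%g = l (v ^+ k)%g.
      by rewrite dist_exp ?leq_addr // addKn.
    have := dD i 1; have := dD i.+1 1; have := dD i 2.
    by rewrite !addn1 addn2 expg1; lia.
  by have := dist_local_to_global (ltn0Sn D) step (leqnSn n.+1) isT; rewrite !dist1x.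
exists (l v + D); split=> [n [|m]|n].
- by rewrite addn0 expg0 (length1 hyp); lia.
- have := four_point hyp (v ^- n)%g v 1%g (v ^+ m.+1)%g.
  have := dist_expV v n 1; have := dist_expV v n m.+1.
  have := @dist_exp v 1 m.+1 isT; rewrite subn1 !expg1 => -> -> ->.
  rewrite dist1x distx1 distx1 (lengthV hyp).
  by have := grow m; have := grow n; rewrite addn1 /=; lia.
by elim: n => // n IH; have := grow n; lia.
Qed.

End Hyperbolic.

Section Loxodromic.
Context {G : groupType} {l : G -> nat} {D : nat} (hyp : hyperbolic_length l D).
Implicit Types (x y z w p q g h v u : G).

Local Notation d := (dist l).
Local Notation loxodromic := (loxodromic l).

Lemma length_conj x p :
  l (p^-1 * x * p)%g <= l x + 2 * l p /\ l x <= l (p^-1 * x * p)%g + 2 * l p.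
Proof.
suff H y q : l (q^-1 * y * q)%g <= l y + 2 * l q.
  by split=> //; have := H (p^-1 * x * p)%g (p^-1)%g; rewrite !gnorm (lengthV hyp).
have := lengthM hyp (q^-1 * y)%g q; have := lengthM hyp (q^-1)%g y.
by rewrite (lengthV hyp); group_lia.
Qed.

Lemma exp_conj v p n : ((p^-1 * v * p) ^+ n = p^-1 * v ^+ n * p)%g.
Proof. by rewrite -!mulgA -!conjgE conjXg. Qed.

Lemma loxodromic_conj v p : loxodromic (p^-1 * v * p)%g -> loxodromic v.
Proof.
move=> [C [HA HG]]; exists (C + 6 * l p).
have Hn n := length_conj (v ^+ n)%g p; split=> [n m|n].
  have := HA n m; have := Hn n; have := Hn m; have := Hn (n + m)%N.
  by rewrite !exp_conj; group_lia.
by have := HG n; have := Hn n; rewrite !exp_conj; group_lia.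
Qed.

Lemma loxodromic_exp v n : 0 < n -> loxodromic v -> loxodromic (v ^+ n)%g.
Proof.
move=> n0 [C [HA HG]]; exists C; split=> [i j|i]; rewrite -!expgnA.
  by rewrite mulnDr; apply: HA.
by have := HG (n * i)%N; have : i <= n * i by [rewrite leq_pmull]; group_lia.
Qed.

Lemma loxodromicV v : loxodromic v -> loxodromic (v^-1)%g.
Proof.
by move=> [C H]; exists C; split=> [i j|i];
  rewrite !expVgn !(lengthV hyp); [apply H.1 | apply H.2].
Qed.

(** Otherwise the conjugate of v by p would satisfy the inequality of
    [loxodromic_square]. *)
Lemma not_loxodromic_displacement v p :
  ~ loxodromic v -> d p (v * v * p)%g <= d p (v * p)%g + 2 * D.
Proof.
move=> Nv; rewrite leqNgt; apply/negP => H; apply: Nv.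
apply: (@loxodromic_conj v p); apply: (loxodromic_square hyp).
by move: H; rewrite exp_conj expg2 /dist !mulgA; group_lia.
Qed.

Lemma not_loxodromic_square v : ~ loxodromic v -> l (v * v)%g <= l v + 2 * D.
Proof.
move=> /(not_loxodromic_displacement 1%g).
by rewrite !mulg1 !dist1x.
Qed.

(** A non-loxodromic g moves the midpoint of a geodesic from 1 to g very little,
    like a rotation. If d g h were larger, the midpoints for g and h would be
    far apart and the product of the two rotations would be loxodromic. *)
Lemma not_loxodromic_ultrametric g h :
  ~ loxodromic g -> ~ loxodromic h -> ~ loxodromic (g^-1 * h)%g ->
  d g h <= maxn (l g) (l h) + 4 * D + 1.
Proof.
move=> /not_loxodromic_square g2 /not_loxodromic_square h2.
move=> /not_loxodromic_square; set w := (g^-1 * h)%g => w2.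
have lw : d g h = l w by [].
have four_pt := four_point hyp; have dist_sym := dist_sym hyp.
have d2 x : d x x^-1%g = l (x * x)%g.
  by rewrite /dist -(lengthV hyp) !gnorm.
have dwg : d w g^-1%g = l h by rewrite dist_sym /w dist_mulr.
have dwh : d h^-1%g w^-1%g = l g by rewrite /w invgM invgK dist_mulr.
have lV := lengthV hyp; have := lV g; have := lV h; have := lV w.
have dist1x := @dist1x G l; have distx1 := distx1 hyp.
have := four_pt g h 1%g g^-1%g.
have := four_pt g^-1%g h h^-1%g 1%g.
have := four_pt g^-1%g h^-1%g 1%g w.
have := four_pt w h^-1%g 1%g w^-1%g.
rewrite !d2 !dist1x !distx1 (dist_sym h^-1%g w) (dist_sym g^-1%g w) dwg dwh.
by rewrite (dist_sym h g^-1%g) lw; group_lia.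
Qed.
End Loxodromic.

(** * Infinite subgroups contain loxodromic elements *)

Lemma bounded_prefix (f : nat -> nat) N : exists L, forall i, i <= N -> f i <= L.
Proof.
elim: N => [|N [L HL]]; first by exists (f 0) => i; rewrite leqn0 => /eqP->.
exists (maxn L (f N.+1)) => i; rewrite leq_eqVlt => /orP[/eqP->|/HL]; lia.
Qed.

Lemma infinite_uniq_seq (T : eqType) (A : set T) n : ~ finite_set A ->
  exists s, [/\ uniq s, size s = n & forall x, x \in s -> A x].
Proof.
move=> infA; elim: n => [|n [s [us ss sA]]]; first by exists [::].
have [x Ax xs] : exists2 x, A x & x \notin s.
  apply: contrapT => H; apply: infA; apply: (@sub_finite_set _ _ [set` s]) => //.
  by move=> x Ax; apply/negPn/negP => xs; apply: H; exists x.
exists (x :: s); split=> /=; rewrite ?xs ?us ?ss // => y.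
by rewrite inE => /orP[/eqP->|/sA].
Qed.

Section ExistsLoxodromic.
Context {G : groupType} {l : G -> nat} {D : nat} (hyp : hyperbolic_length l D).
Implicit Types (x y z w p q g h v u : G) (F : set G).

Local Notation d := (dist l).
Local Notation loxodromic := (loxodromic l).

(** Here p lies at distance t from 1 on a geodesic from 1 to h. In the
    quadrilateral 1, g, g h, h both p and g p are far from the short sides, so
    that g p, too, lies close to the geodesic from 1 to h, but farther from h
    by about d g h - l h. *)
Lemma quadrilateral_shift L g h p t : l p = t -> d p h + t = l h -> l g <= L ->
    d h (g * h)%g <= l h + L + 4 * D + 1 ->
    L + D <= t -> t + 2 * L + 4 * D + 1 <= l h - t ->
  [/\ d (g * p)%g h + t <= d g h + D, d 1%g (g * p)%g + d g h <= t + l h + D &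
      d p (g * p)%g + l h <= maxn (t + d (g * p)%g h) (d p h + d 1%g (g * p)%g) + D].
Proof.
move=> lp ph gL hgh tL tU.
have four_pt := four_point hyp; have dist_sym := dist_sym hyp.
have dist1x := @dist1x G l; have distx1 := distx1 hyp.
have A1 := four_pt (g * p)%g h g (g * h)%g.
have A2 := four_pt 1%g (g * p)%g g h.
have A3 := four_pt p (g * p)%g 1%g h.
have B1 : d (g * p)%g g = t by rewrite dist_sym dist_mulr.
have B2 : d (g * p)%g (g * h)%g = d p h by rewrite dist_mull.
have B3 : d g (g * h)%g = l h by rewrite dist_mulr.
have B4 := dist_sym h g; have B5 := dist_sym (g * p)%g g.
have B6 := dist_sym (g * p)%g 1%g.
have B7 := dist_triangle hyp g 1%g h; have B8 := dist_triangle hyp 1%g g h.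
move: A1 A2 A3 B7 B8; rewrite !dist1x !distx1.
by split; group_lia.
Qed.

(** The shift d g h - l h of g is doubled when g is replaced by g * g, whereas
    g * g displaces p hardly more than g does; so the shift is bounded, and with
    it the displacement of p. *)
Lemma elliptic_displacement L g h p t :
    ~ loxodromic g ->
    l p = t -> d p h + t = l h -> 2 * l g <= L ->
    d h (g * h)%g <= l h + L + 4 * D + 1 ->
    d h (g * g * h)%g <= l h + L + 4 * D + 1 ->
    L + D <= t -> t + 2 * L + 4 * D + 1 <= l h - t -> 
  d p (g * p)%g <= 8 * D.
Proof.
move=> Ng lp ph gL hg hgg tL tU.
have gg : l (g * g)%g <= L by have := lengthM hyp g g; lia.
have gL' : l g <= L by lia.
have [P1 P2 P3] := quadrilateral_shift lp ph gL' hg tL tU.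
have [Q1 Q2 Q3] := quadrilateral_shift lp ph gg hgg tL tU.
have := not_loxodromic_displacement hyp p Ng.
have := four_point hyp (g * g)%g h g (g * h)%g.
rewrite !dist_mulr dist_mull (dist_sym hyp (g * g)%g g) dist_mulr.
have := four_point hyp (g * g)%g (g * h)%g g h.
rewrite dist_mull (dist_sym hyp (g * g)%g g) (dist_sym hyp (g * h)%g g) !dist_mulr.
have := dist_triangle hyp p (g * g * p)%g h.
have := dist_triangle hyp (g * g * p)%g (g * g)%g h.
have := dist_triangle hyp (g * g * p)%g 1%g h.
have := dist_triangle hyp p 1%g (g * g * p)%g.
have := dist_triangle hyp 1%g g h; have := dist_triangle hyp g 1%g h.
have := dist_sym hyp (g * g * p)%g p; have := dist_sym hyp h g.
have := dist_sym hyp (g * h)%g h.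
rewrite !dist1x in P2 P3 Q2 Q3.
rewrite !dist_mulr !(distx1 hyp) !dist1x.
group_lia.
Qed.

(** If no element of F is loxodromic, then arbitrarily many elements of F move a
    point p by at most 8 D, provided that p lies far out on a geodesic from 1 to
    a very long element of F. Their conjugates by p are distinct elements of the
    ball of radius 8 D, which is finite. *)
Lemma infinite_subgroup_loxodromic F :
  subgroup F -> ~ finite_set F -> exists2 v, F v & loxodromic v.
Proof.
move=> sgF infF; apply: contrapT => nolox.
have {}nolox g : F g -> ~ loxodromic g by move=> Fg lg; apply: nolox; exists g.
have [N HN] := finite_set_repeats (finite_ball hyp (8 * D)).
have [s [us ss sF]] := infinite_uniq_seq N.+1 infF.
pose f i := nth 1%g s i.
have fF i : i <= N -> F (f i) by move=> iN; apply/sF/mem_nth; rewrite ss ltnS.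
have [L HL] := bounded_prefix (fun i => 2 * l (f i)) N.
pose t := L + D.
have [h Fh lh] : exists2 h, F h & 2 * t + 2 * L + 4 * D + 1 <= l h.
  apply: contrapT => H; apply: infF.
  apply: (sub_finite_set _ (finite_ball hyp (2 * t + 2 * L + 4 * D + 1))).
  move=> h Fh; rewrite /= leqNgt; apply/negP => hl; apply: H; exists h => //.
  exact: ltnW.
have [|p [lp ph]] := length_split hyp (x := h) (t := t); first lia.
have near g : F g -> l g <= L -> d h (g * h)%g <= l h + L + 4 * D + 1.
  move=> Fg gL; have Fgh : F (g * h)%g by apply: subgroupM.
  have Fhgh : F (h^-1 * (g * h))%g by apply: subgroupM => //; apply: subgroupV.
  have := not_loxodromic_ultrametric hyp (nolox _ Fh) (nolox _ Fgh) (nolox _ Fhgh).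
  by have := lengthM hyp g h; group_lia.
have [|i [j [/andP[ij jN] fij]]] := HN (fun i => (p^-1 * (f i * p))%g).
  move=> i iN; have Fi := fF i iN; have := HL i iN => /= Li.
  have Fii : F (f i * f i)%g by apply: subgroupM.
  have lii := lengthM hyp (f i) (f i).
  apply: (@elliptic_displacement L (f i) h p t (nolox _ Fi) lp) => //.
  - by rewrite /dist ph; lia.
  - by apply: near; rewrite //; lia.
  - by apply: near; rewrite //; lia.
  - lia.
have /eqP : f i = f j by apply: (@mulIg _ p); apply: (@mulgI _ p^-1%g).
by rewrite nth_uniq ?ss ?ltnS //; lia.
Qed.
End ExistsLoxodromic.

(** * The commensurator of a loxodromic element *)

Section Commensurator.
Context {G : groupType}.
Implicit Types (x y z v : G).

(** For z of infinite order, this says that x normalizes the subgroup generated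
    by z. *)
Definition preserves z x : Prop :=
  (x * z * x^-1 = z \/ x * z * x^-1 = z^-1)%g.

Definition commensurator v : set G :=
  [set x | exists2 n, 0 < n & preserves (v ^+ n)%g x].

Lemma preserves_subgroup z : subgroup [set x | preserves z x].
Proof.
have V x : preserves z x -> preserves z x^-1%g.
  case=> e; [left|right]; first by rewrite -{1}e !gnorm.
  by rewrite -[X in (_ * X * _)%g](invgK z) -{1}e !gnorm.
apply/subgroupP; split=> [|x y Px /V Py]; first by left; rewrite !gnorm.
rewrite /= /preserves.
have e : (x * y^-1 * z * (x * y^-1)^-1 = x * (y^-1 * z * y^-1^-1) * x^-1)%g.
  by rewrite !gnorm.
have xV : (x * z^-1 * x^-1 = (x * z * x^-1)^-1)%g by rewrite !gnorm.
rewrite e; case: Py => ->; rewrite ?xV; case: Px => ->; rewrite ?invgK; by [left|right].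
Qed.

Lemma preserves_exp z x n : preserves z x -> preserves (z ^+ n)%g x.
Proof.
rewrite /preserves -[(z ^+ n)%g]/(zpow z n%:Z) zpow_conj -zpowN.
by case=> ->; [left | right; rewrite -mulN1r zpowM (zpowN z 1)].
Qed.

Lemma preserves_exp_mul v x n m :
  preserves (v ^+ n)%g x -> preserves (v ^+ (n * m))%g x.
Proof. by rewrite expgnA; apply: preserves_exp. Qed.

Lemma preserves_sign z x : preserves z x ->
  exists e : bool, forall k, (x * zpow z k = zpow z (if e then k else - k)%R * x)%g.
Proof.
move=> Px; have E k : (x * zpow z k = zpow (x * z * x^-1)%g k * x)%g.
  by rewrite -zpow_conj mulgVK.
case: Px => e; [exists true | exists false] => k; rewrite E e //.
by rewrite -mulN1r zpowM.
Qed.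

Lemma preserves_commute z x : preserves z x ->
  exists e : bool, forall k, (zpow z k * x = x * zpow z (if e then k else - k)%R)%g.
Proof.
by move=> /preserves_sign[e He]; exists e => k; rewrite He; case: e {He}; rewrite ?opprK.
Qed.

Lemma commensurator_subgroup v : subgroup (commensurator v).
Proof.
apply/subgroupP; split=> [|x y [n n0 Pn] [m m0 Pm]].
  by exists 1 => //; apply: (subgroup1 (preserves_subgroup _)).
exists (n * m)%N; first by rewrite muln_gt0 n0.
have /subgroupP[_] := preserves_subgroup (v ^+ (n * m))%g; apply => /=.
  exact: preserves_exp_mul.
by rewrite mulnC; apply: preserves_exp_mul.
Qed.

Lemma commensurator_uniform v (s : seq G) : (forall x, x \in s -> commensurator v x) ->
  exists2 n, 0 < n & forall x, x \in s -> preserves (v ^+ n)%g x.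
Proof.
elim: s => [|x s IH] H; first by exists 1.
have [|n n0 Hn] := IH; first by move=> y ys; apply: H; rewrite inE ys orbT.
have [m m0 Hm] := H x (mem_head _ _).
exists (n * m)%N => [|y]; first by rewrite muln_gt0 n0.
rewrite inE => /orP[/eqP->|/Hn]; last exact: preserves_exp_mul.
by rewrite mulnC; apply: preserves_exp_mul.
Qed.
End Commensurator.

Lemma reach_by_steps (f : nat -> nat) s a m : f 0 <= a -> a <= f m ->
    (forall j, f j.+1 <= f j + s) ->
  exists2 j, j <= m & f j <= a <= f j + s.
Proof.
move=> f0 + fS; elim: m => [|m IH] am.
  by exists 0 => //; rewrite f0 (leq_trans am) ?leq_addr.
have [/IH[j jm H]|lt] := leqP a (f m); first by exists j => //; apply: leqW.
by exists m => //; have := fS m; lia.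
Qed.

Section Independence.
Context {G : groupType} {l : G -> nat} {D : nat} (hyp : hyperbolic_length l D).
Implicit Types (x y z w g h v u : G).

Local Notation d := (dist l).
Local Notation loxodromic := (loxodromic l).

Lemma length_zpow v k : l (zpow v k) = l (v ^+ `|k|%N)%g.
Proof. by case: k => n //=; rewrite (lengthV hyp). Qed.

(** Conjugation by x changes lengths by at most 2 l x, whereas the difference
    between the lengths of v^(m |q|) and v^(m |p|) would grow with m. *)
Lemma loxodromic_exponents_le v x (p q : int) : loxodromic v ->
  (x * zpow v p * x^-1)%g = zpow v q -> `|q|%N <= `|p|%N.
Proof.
move=> [C [HA HG]] e; rewrite leqNgt; apply/negP => lt.
pose m := (2 * l x + 2 * C + 1)%N.
have em : (x * zpow v (p * m%:Z)%R * x^-1)%g = zpow v (q * m%:Z)%R.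
  by rewrite !zpowM zpow_conj e.
have := lengthM hyp (x * zpow v (p * m%:Z)%R)%g x^-1%g.
have := lengthM hyp x (zpow v (p * m%:Z)%R).
rewrite em !length_zpow (lengthV hyp) !abszM !absz_nat.
have := HA (`|p|%N * m)%N ((`|q|%N - `|p|%N) * m)%N.
have := HG ((`|q|%N - `|p|%N) * m)%N.
rewrite -mulnDl subnKC ?(ltnW lt) //.
have : m <= (`|q|%N - `|p|%N) * m by rewrite leq_pmull // subn_gt0.
rewrite /m; group_lia.
Qed.

Lemma loxodromic_exponents v x (p q : int) : loxodromic v ->
  (x * zpow v p * x^-1)%g = zpow v q -> `|p|%N = `|q|%N.
Proof.
move=> lv e; apply/eqP; rewrite eqn_leq (loxodromic_exponents_le lv e) andbT.
apply: (@loxodromic_exponents_le v x^-1%g q p) => //.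
by rewrite -e !gnorm.
Qed.

Lemma loxodromic_zpow_inj v (p q : int) : loxodromic v -> zpow v p = zpow v q -> p = q.
Proof.
move=> lv e; apply/eqP; rewrite -subr_eq0 -absz_eq0; apply/eqP.
apply/esym; apply: (@loxodromic_exponents v 1%g 0 _ lv).
by rewrite zpowD zpowN e !gnorm.
Qed.

Lemma commensurator_intro v x (p q : int) : loxodromic v -> p != 0%R ->
  (x * zpow v p * x^-1)%g = zpow v q -> commensurator v x.
Proof.
move=> lv p0 e; have pq := loxodromic_exponents lv e.
exists `|p|%N; first by rewrite absz_gt0.
rewrite /preserves -[(v ^+ _)%g]/(zpow v (Posz `|p|%N)) -zpowN.
have [p'|p'] : p = (Posz `|p|%N) \/ p = (- (Posz `|p|%N))%R by lia.
  rewrite -p' e; have [->|->] : q = p \/ q = (- p)%R by lia.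
    by left.
  by right.
have -> : (x * zpow v `|p|%N * x^-1)%g = zpow v (- q)%R.
  by rewrite zpowN -e p' abszN absz_nat zpowN !gnorm.
have [->|->] : q = p \/ q = (- p)%R by lia.
  by left; congr (zpow _ _); lia.
by right; congr (zpow _ _); lia.
Qed.

(** The hypothesis says that the quasi-geodesics from 1 through the powers of w1
    and from x through x w2^j have a long common initial part; so each early
    point of the first one is close to the geodesic from x to x w2^m, hence to
    the point x w2^j at about the same distance from 1. *)
Lemma fellow_traveller w1 w2 x C1 C2 i n m :
    (forall n m, l (w1 ^+ n)%g + l (w1 ^+ m)%g <= l (w1 ^+ (n + m))%g + C1) ->
    (forall n m, l (w2 ^+ n)%g + l (w2 ^+ m)%g <= l (w2 ^+ (n + m))%g + C2) ->
    i <= n ->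
    d (w1 ^+ n)%g (x * w2 ^+ m)%g + (2 * l (w1 ^+ i)%g + 2 * l x + C1 + 2 * D)
      <= l (w1 ^+ n)%g + l (w2 ^+ m)%g ->
  exists j, d (w1 ^+ i)%g (x * w2 ^+ j)%g <= 3 * l x + l w2 + C1 + C2 + 3 * D.
Proof.
move=> H1 H2 ile H.
pose A i := (w1 ^+ i)%g; pose B j := (x * w2 ^+ j)%g.
have lB j : l (B j) <= l x + l (w2 ^+ j)%g by apply: (lengthM hyp).
have Bl j : l (w2 ^+ j)%g <= l x + l (B j).
  by have := lengthM hyp x^-1%g (B j); rewrite mulKg (lengthV hyp).
have [|||j jm /andP[ja aj]] :=
    @reach_by_steps (fun j => l (w2 ^+ j)%g) (l w2) (l (A i)) m.
- by rewrite expg0 (length1 hyp).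
- have := dist_triangle hyp (B m) 1%g (A n); rewrite !dist1x (dist_sym hyp (B m)).
  by have := lB m; move: H; rewrite -/(A n) -/(A i) -/(B m); lia.
- by move=> j; rewrite expgSr; apply: (lengthM hyp).
exists j; rewrite -/(A i) -/(B j).
have := four_point hyp (A i) (B m) 1%g (A n).
have := four_point hyp (A i) (B j) 1%g (B m).
have : d (A i) (A n) = l (A (n - i)) := dist_exp w1 ile.
have : d (B j) (B m) = l (w2 ^+ (m - j))%g by rewrite dist_mull dist_exp.
have := H1 i (n - i); have := H2 j (m - j); rewrite !subnKC //.
have := lB m; have := lB j; have := Bl m; have := Bl j.
move: H; rewrite -/(A i) -/(A n) -/(A (n - i)) -/(B m) !dist1x !(distx1 hyp).
have := dist_sym hyp (B m) (A n).
lia.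
Qed.

(** If no constant works, then N + 1 points w1^i are close to points x w2^j, and
    two of the differences w1^-i x w2^j coincide, since they lie in a fixed
    ball; this gives a relation between a power of w1 and a conjugate of a power
    of w2. *)
Lemma independent_powers w1 w2 x : loxodromic w1 -> loxodromic w2 ->
    (forall p q, 0 < p -> (x * zpow w2 q * x^-1)%g <> (w1 ^+ p)%g) ->
  exists C, forall n m,
    l (w1 ^+ n)%g + l (w2 ^+ m)%g <= d (w1 ^+ n)%g (x * w2 ^+ m)%g + C.
Proof.
move=> [C1 [H1 _]] [C2 [H2 _]] Hx.
have [N HN] := finite_set_repeats
  (finite_ball hyp (3 * l x + l w2 + C1 + C2 + 3 * D)).
have [L HL] := bounded_prefix (fun i => l (w1 ^+ i)%g) N.
exists (2 * L + 2 * l x + C1 + 2 * D + 1) => n m; rewrite leqNgt; apply/negP => lt.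
have Nn : N <= n.
  rewrite leqNgt; apply/negP => /ltnW/HL.
  have := dist_triangle hyp (x * w2 ^+ m)%g (w1 ^+ n)%g 1%g.
  have := dist_triangle hyp (w1 ^+ n)%g 1%g (x * w2 ^+ m)%g.
  have := lengthM hyp x^-1%g (x * w2 ^+ m)%g; rewrite mulKg (lengthV hyp).
  by move: lt; rewrite !dist1x; group_lia.
have near i : exists j, i <= N ->
    d (w1 ^+ i)%g (x * w2 ^+ j)%g <= 3 * l x + l w2 + C1 + C2 + 3 * D.
  have [iN|] := leqP i N; last by exists 0.
  have [|j Hj] := @fellow_traveller w1 w2 x C1 C2 i n m H1 H2 (leq_trans iN Nn).
    by have := HL i iN; move: lt; rewrite /=; lia.
  by exists j.
have [J HJ] := choice near.
have [|i [i' [/andP[ii' _] e]]] := HN (fun i => (w1 ^- i * (x * w2 ^+ J i))%g).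
  by move=> i iN; apply: HJ.
apply: (Hx (i' - i) (Posz (J i') - Posz (J i))%R); first by rewrite subn_gt0.
rewrite expgnFr ?(ltnW ii') // zpowD zpowN /=.
apply: (mulIg (x * w2 ^+ J i)%g); rewrite /= -[in RHS]mulgA e mulVKg.
by rewrite !gnorm.
Qed.

Lemma independence v x : loxodromic v -> ~ commensurator v x ->
  exists C, forall n m,
    l (zpow v n) + l (zpow v m) <= l (zpow v n * x * zpow v m)%g + C.
Proof.
move=> lv Nx; pose w (e : bool) := if e then v else v^-1%g.
have lw e : loxodromic (w e) by case: e => //; apply: (loxodromicV hyp).
pose s (e : bool) : int := if e then 1%R else (-1)%R.
have wE e k : zpow (w e) k = zpow v (s e * k)%R.
  by rewrite zpowM; congr zpow; case: e.
have : forall e, exists C, forall e', forall n m,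
    l (w e ^+ n)%g + l (w e' ^+ m)%g <= d (w e ^+ n)%g (x * w e' ^+ m)%g + C.
  move=> e; have H e' : exists C, forall n m,
      l (w e ^+ n)%g + l (w e' ^+ m)%g <= d (w e ^+ n)%g (x * w e' ^+ m)%g + C.
    apply: independent_powers => // p q p0; rewrite -[(_ ^+ p)%g]/(zpow (w e) p) !wE.
    move=> E; apply: Nx; have [q0|q0] := eqVneq q 0%R.
      move: E; rewrite q0 mulr0 mulg1 mulgV -[RHS]/(zpow v _).
      by move/(@loxodromic_zpow_inj v 0%R _ lv); case: (e) => /=; lia.
    by apply: (commensurator_intro lv _ E); case: (e') => /=; lia.
  have [C HC] := H true; have [C' HC'] := H false; exists (C + C') => -[] n m.
    by apply: leq_trans (HC n m) _; lia.
  by apply: leq_trans (HC' n m) _; lia.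
move=> H; have [C HC] := H true; have [C' HC'] := H false.
exists (C + C') => n m.
have zE k : exists e, zpow v k = (w e ^+ `|k|%N)%g.
  by case: k => k; [exists true | exists false; rewrite /= expVgn].
have zVE k : exists e,
    zpow v k = (w e ^- `|k|%N)%g /\ l (zpow v k) = l (w e ^+ `|k|%N)%g.
  case: k => k; [exists false | exists true]; rewrite /= ?expVgn ?invgK ?(lengthV hyp) //.
have [e [-> ->]] := zVE n; have [e' ->] := zE m.
rewrite -mulgA; case: e.
  by apply: leq_trans (HC e' _ _) _; rewrite /dist; group_lia.
by apply: leq_trans (HC' e' _ _) _; rewrite /dist; group_lia.
Qed.

(** Let y be a shortest element of its coset, and suppose that it is longer than
    z^2n. Left translation by z^2n displaces 1 and y by the same amount, so that
    y is hardly farther from z^2n than from 1. Hence y is closer to the middle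
    point z^n than to 1, that is, z^-n y is shorter than y; but it lies in the
    same coset as y. *)
Lemma preserving_coset_bounded z : loxodromic z ->
  exists B, forall h, preserves z h -> exists k, l (h * zpow z k)%g <= B.
Proof.
move=> [C [HA HG]]; have [n nE] : exists n, n = 2 * C + 2 * D + 1 by eexists.
exists (l (z ^+ (n + n))%g) => h Ph.
pose P a := `[< exists k, l (h * zpow z k)%g = a >].
have exP : exists a, P a by exists (l h); apply/asboolP; exists 0%R; rewrite mulg1.
case: (ex_minnP exP) => a /asboolP[k ka] amin.
exists k; rewrite ka leqNgt; apply/negP => lt.
pose y := (h * zpow z k)%g; have ly : l y = a by [].
have miny j : a <= l (y * zpow z j)%g.
  by apply: amin; apply/asboolP; exists (k + j)%R; rewrite zpowD mulgA.
have Py : preserves z y.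
  apply: (subgroupM (preserves_subgroup z)) => //.
  by left; rewrite -{2}(expg1 z) -[(z ^+ 1)%g]/(zpow z 1) -zpowD addrC zpowD mulgK.
have [e zy] := preserves_commute Py.
have disp m : d y (z ^+ m * y)%g = l (z ^+ m)%g.
  by rewrite (zy m) dist_mulr length_zpow; case: (e); rewrite ?abszN.
have far m : l (z ^+ m)%g <= a -> d (z ^+ m)%g y <= a + D.
  move=> lma; have := four_point hyp (z ^+ m)%g y 1%g (z ^+ m * y)%g.
  have := miny (if e then m : int else - m%:Z)%R; rewrite -(zy m) -[zpow z m]/(z ^+ m)%g.
  by rewrite disp dist_mulr !dist1x !(distx1 hyp) ly; group_lia.
have near : a <= d (z ^+ n)%g y.
  by rewrite /dist -[(z ^- n)%g]/((zpow z n)^-1)%g -zpowN zy.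
have := four_point hyp y (z ^+ n)%g 1%g (z ^+ (n + n))%g.
have := far (n + n)%N (ltnW lt); have := HA n n; have := HG n.
rewrite dist1x (distx1 hyp) dist_exp ?leq_addr // addKn.
by rewrite !(dist_sym hyp y) !(distx1 hyp) ly; group_lia.
Qed.
End Independence.

(** * Ping-pong *)

Lemma uniform_bound (T : eqType) (P : T -> nat -> Prop) (s : seq T) :
    (forall x m n, m <= n -> P x m -> P x n) ->
    (forall x, x \in s -> exists n, P x n) ->
  exists n, forall x, x \in s -> P x n.
Proof.
move=> mono; elim: s => [|x s IH] H; first by exists 0.
have [|n Hn] := IH; first by move=> y ys; apply: H; rewrite inE ys orbT.
have [m Hm] := H x (mem_head _ _); exists (n + m) => y.
rewrite inE => /orP[/eqP->|/Hn]; apply: mono Hm || apply: mono; lia.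
Qed.

(** The index s records the leading letter of a product without cancelling
    neighbours. *)
Inductive reduced (G : groupType) (S : set G) : G -> G -> Prop :=
| ReducedLetter s : S s -> reduced S s s
| ReducedMul s t x : S s -> reduced S t x -> (s * t)%g <> 1%g ->
    reduced S s (s * x)%g.

Section PingPong.
Context {G : groupType} {l : G -> nat} {D : nat} (hyp : hyperbolic_length l D).
Implicit Types (x y z w g h v u s t : G) (S : set G).

Local Notation d := (dist l).
Local Notation loxodromic := (loxodromic l).

Lemma reduced_mem S s x : reduced S s x -> S s.
Proof. by case. Qed.

Definition long_products S :=
  (forall s, S s -> D < l s) /\
  (forall s t, S s -> S t -> (s * t)%g = 1%g \/
     maxn (l s) (l t) + 2 * D + 1 <= l (s * t)%g).

(** For a letter s put in front of a reduced product x with leading letter t, the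
    four-point inequality for 1, s, s t and s x shows that s x is longer
    than x. *)
Lemma reduced_long S s x : long_products S -> reduced S s x ->
  l (s^-1 * x)%g + D.+1 <= l x /\ l s <= l x.
Proof.
move=> [Sl Sm]; elim=> {s x} [s /Sl|s t x Ss Rx [IH1 IH2] st1].
  by rewrite mulVg (length1 hyp).
have [//|lst] := Sm _ _ Ss (reduced_mem Rx).
have := four_point hyp s (s * x)%g 1%g (s * t)%g.
have e : d (s * x)%g (s * t)%g = l (t^-1 * x)%g by rewrite dist_mull (dist_sym hyp).
rewrite !dist_mulr !dist1x e (distx1 hyp s) (distx1 hyp) mulKg; group_lia.
Qed.

Lemma generated_long S : (forall s, S s -> S s^-1%g) -> long_products S ->
  forall x, generated S x -> x = 1%g \/ exists2 s, S s & l s <= l x.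
Proof.
move=> SV Slong x.
pose P := [set x | x = 1%g \/ exists s, reduced S s x].
have PS s y : S s -> P y -> P (s * y)%g.
  move=> Ss [->|[t Rty]]; first by right; exists s; rewrite mulg1; constructor.
  have [st1|] := pselect ((s * t)%g = 1%g); last by right; exists s; econstructor; eauto.
  case: Rty st1 => {t y} [t _ ->|t t' y _ Rt't _ st1]; first by left.
  by right; exists t'; rewrite mulgA st1 mul1g.
have /[apply] : generated S `<=` P.
  apply: generated_translate => [|s y Ss Py]; first by left.
  by split; apply: PS => //; apply: SV.
case=> [->|[s Rsx]]; [by left | right]; exists s; first exact: reduced_mem Rsx.
by case: (reduced_long Slong Rsx).
Qed.

(** The local-to-global principle, applied to the path whose steps are the four
    syllables. *)
Lemma four_syllables C R Z v (m1 m2 m3 m4 : int) y1 y2 y3 :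
    (forall m, m \in [:: m1; m2; m3; m4] -> l (zpow v m) = Z) ->
    (forall y, y \in [:: y1; y2; y3] -> l y <= R /\
       forall n m, l (zpow v n) + l (zpow v m) <= l (zpow v n * y * zpow v m)%g + C) ->
    C + 2 * R + D < Z ->
  4 * Z <= l (zpow v m1 * (y1 * zpow v m2) * (y2 * zpow v m3) * (y3 * zpow v m4))%g
           + 4 * C + 8 * R + 4 * D.
Proof.
move=> Hm Hy HZ.
have L1 : l (zpow v m1) = Z by rewrite Hm ?inE ?eqxx.
have L2 : l (zpow v m2) = Z by rewrite Hm ?inE ?eqxx ?orbT.
have L3 : l (zpow v m3) = Z by rewrite Hm ?inE ?eqxx ?orbT.
have L4 : l (zpow v m4) = Z by rewrite Hm ?inE ?eqxx ?orbT.
have [|R1 I1] := Hy y1; first by rewrite !inE eqxx.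
have [|R2 I2] := Hy y2; first by rewrite !inE eqxx orbT.
have [|R3 I3] := Hy y3; first by rewrite !inE eqxx !orbT.
pose f1 := zpow v m1; pose f2 := (f1 * (y1 * zpow v m2))%g.
pose f3 := (f2 * (y2 * zpow v m3))%g; pose f4 := (f3 * (y3 * zpow v m4))%g.
pose f i := nth 1%g [:: 1%g; f1; f2; f3; f4] i.
have a0 : 0 < Z - C - 2 * R - D by lia.
have e1 : d 1%g f1 = Z by rewrite dist1x.
have e2 : d f1 f2 <= Z + R.
  by rewrite dist_mulr; have := lengthM hyp y1 (zpow v m2); group_lia.
have e3 : d f2 f3 <= Z + R.
  by rewrite dist_mulr; have := lengthM hyp y2 (zpow v m3); group_lia.
have e4 : d f3 f4 <= Z + R.
  by rewrite dist_mulr; have := lengthM hyp y3 (zpow v m4); group_lia.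
have c1 : 2 * Z <= d 1%g f2 + C + R.
  by rewrite dist1x /f2 mulgA /f1; have := I1 m1 m2; group_lia.
have skip y y' m m' : l y <= R -> l (zpow v m) = Z -> l (zpow v m') = Z ->
    (forall n m, l (zpow v n) + l (zpow v m) <= l (zpow v n * y' * zpow v m)%g + C) ->
    2 * Z <= l ((y * zpow v m) * (y' * zpow v m'))%g + C + R.
  move=> yR lm lm' I; have := I m m'.
  have := lengthM hyp y^-1%g ((y * zpow v m) * (y' * zpow v m'))%g.
  by rewrite (lengthV hyp) !mulgA mulVg mul1g; group_lia.
have c2 : 2 * Z <= d f1 f3 + C + R by rewrite /f3 /f2 -mulgA dist_mulr; apply: skip.
have c3 : 2 * Z <= d f2 f4 + C + R by rewrite /f4 /f3 -mulgA dist_mulr; apply: skip.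
have H i : i.+1 < 4 ->
    maxn (d (f i) (f i.+1)) (d (f i.+1) (f i.+2)) + (Z - C - 2 * R - D) + D
      <= d (f i) (f i.+2).
  by case: i => [|[|[|//]]] _; rewrite /f /=; lia.
have := dist_local_to_global hyp a0 H (i := 1).
have := dist_local_to_global hyp a0 H (i := 2).
have := dist_local_to_global hyp a0 H (i := 3).
rewrite /f /= (dist1x f4) -/f1 -/f2 -/f3 -/f4.
by rewrite e1; group_lia.
Qed.

Lemma length_sandwich g x h :
  l x <= l g + l (g * x * h)%g + l h /\ l (g * x * h)%g <= l g + l x + l h.
Proof.
have lm (a b c : G) : l (a * b * c)%g <= l a + l b + l c.
  by have := lengthM hyp (a * b)%g c; have := lengthM hyp a b; group_lia.
split=> //; have := lm g^-1%g (g * x * h)%g h^-1%g.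
by rewrite !mulgA mulVg mul1g mulgK !(lengthV hyp); group_lia.
Qed.

(** The even and odd powers of u at the two ends of the generators are all
    different. So in a product of two generators or inverses of generators
    that are not inverse to each other, the ends that meet leave a non-trivial
    power of u between two powers of v, and [four_syllables] applies. *)
Lemma ping_pong_subgroup v u (hs : seq G) N : loxodromic v ->
    (forall h, h \in hs -> ~ commensurator v h) ->
    (forall c, 0 < c -> ~ commensurator v (u ^+ c)%g) ->
  exists M K, [/\ subgroup K,
    forall i, i < size hs -> K (u ^+ (2 * i) * v ^+ M * nth 1 hs i * v ^+ M *
                                u ^- (2 * i).+1)%g &
    forall x, K x -> x = 1%g \/ N < l x].
Proof.
move=> lv Hhs Hu.
pose k := size hs; pose Y := hs ++ [seq (u ^+ c.+1)%g | c <- iota 0 (2 * k)].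
have EY y : y \in Y -> ~ commensurator v y.
  by rewrite mem_cat => /orP[/Hhs//|/mapP[c _ ->]]; apply: Hu.
pose good y C := l y <= C /\ forall n m,
  l (zpow v n) + l (zpow v m) <= l (zpow v n * y * zpow v m)%g + C.
have [C HC] : exists C, forall y, y \in Y -> good y C.
  apply: uniform_bound => [y m n mn [ym H]|y /EY Ey].
    by split=> [|i j]; [lia | have := H i j; group_lia].
  have [C HC] := independence hyp lv Ey.
  by exists (l y + C); split=> [|n m]; [lia | have := HC n m; group_lia].
have [R HR] := bounded_prefix (fun c => l (u ^+ c)%g) (2 * k).
have goodV y : good y C -> good (y^-1)%g C.
  move=> [yC H]; split=> [|n m]; first by rewrite (lengthV hyp).
  have := H (- m)%R (- n)%R; rewrite !zpowN !(lengthV hyp).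
  rewrite -(lengthV hyp (_ * y * _)%g) !invgM !invgK mulgA; group_lia.
have goodh i : i < k -> good (nth 1 hs i)%g C.
  by move=> ik; apply: HC; rewrite mem_cat mem_nth.
have goodu a b : a <= 2 * k -> b <= 2 * k -> a != b -> good (u ^- a * u ^+ b)%g C.
  have lt a' b' : b' <= 2 * k -> a' < b' -> good (u ^- a' * u ^+ b')%g C.
    move=> bk ab; rewrite -(subnKC (ltnW ab)) expgnDr mulKg.
    apply: HC; rewrite mem_cat; apply/orP; right.
    apply/mapP; exists (b' - a').-1; first by rewrite mem_iota; lia.
    by congr (_ ^+ _)%g; lia.
  move=> ak bk; rewrite neq_ltn => /orP[/lt|ba]; first exact.
  rewrite -[(u ^- a * _)%g]invgK invgM invgK; apply: goodV.
  by have := lt b a ak ba; rewrite -[(u ^+ b)^-1%g]/(u ^- b)%g.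
have [C0 [_ HG]] := lv.
(* any M much larger than C, R, D and N would do *)
have [M ME] : exists M, M = C0 + 20 * (C + R + D) + N + 1 by eexists.
have MZ := HG M; have [Z ZE] : exists Z, l (v ^+ M)%g = Z by exists (l (v ^+ M)%g).
rewrite ZE ME in MZ.
(* o = false stands for the inverse of the i-th generator *)
pose e (o : bool) : int := if o then Posz M else (- Posz M)%R.
have lZ o : l (zpow v (e o)) = Z.
  by rewrite (length_zpow hyp) -ZE; case: o; rewrite ?abszN.
pose h i (o : bool) := if o then nth 1%g hs i else (nth 1%g hs i)^-1%g.
have goodho i o : i < k -> good (h i o) C.
  by case: o => ik; [apply: goodh | apply/goodV/goodh].
pose sig i (o : bool) :=
  (u ^+ (2 * i + ~~ o) * (zpow v (e o) * h i o * zpow v (e o)) * u ^- (2 * i + o))%g.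
have sigV i o : (sig i o)^-1%g = sig i (~~ o).
  rewrite /sig !invgM invgK -!zpowN !mulgA negbK.
  by case: o; rewrite /e /h /= ?invgK ?opprK.
pose S := [set x | exists i o, i < k /\ x = sig i o].
have sig_len i o : i < k ->
    2 * Z <= l (sig i o) + C + 2 * R /\ l (sig i o) <= 2 * Z + C + 2 * R.
  move=> ik; set x := (zpow v (e o) * h i o * zpow v (e o))%g.
  have [hC /(_ (e o) (e o))] := goodho i o ik; rewrite -/x !lZ => lx.
  have lx' : l x <= Z + C + Z.
    have := lengthM hyp (zpow v (e o) * h i o)%g (zpow v (e o)).
    by have := lengthM hyp (zpow v (e o)) (h i o); rewrite -/x !lZ; group_lia.
  have r1 : l (u ^+ (2 * i + ~~ o))%g <= R by apply: HR; lia.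
  have r2 : l (u ^- (2 * i + o))%g <= R by rewrite (lengthV hyp); apply: HR; lia.
  have := length_sandwich (u ^+ (2 * i + ~~ o))%g x (u ^- (2 * i + o))%g.
  by rewrite -/(sig i o); lia.
have sig_mul i o j o' : i < k -> j < k -> (sig i o * sig j o')%g = 1%g \/
    4 * Z <= l (sig i o * sig j o')%g + 4 * C + 8 * C + 4 * D + 2 * R.
  move=> ik jk; have [e2|ne] := eqVneq (2 * i + o) (2 * j + ~~ o').
    (* exponents of different parity come from factors that are inverse *)
    have eo : o = ~~ o' by move: e2; case: (o); case: (o'); lia.
    have ei : i = j by move: e2; rewrite eo; lia.
    by left; rewrite ei eo -sigV mulVg.
  right; set p := (zpow v (e o) * (h i o * zpow v (e o)) *
    ((u ^- (2 * i + o) * u ^+ (2 * j + ~~ o')) * zpow v (e o')) *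
    (h j o' * zpow v (e o')))%g.
  have r1 : l (u ^+ (2 * i + ~~ o))%g <= R by apply: HR; lia.
  have r2 : l (u ^- (2 * j + o'))%g <= R by rewrite (lengthV hyp); apply: HR; lia.
  have -> : (sig i o * sig j o' = u ^+ (2 * i + ~~ o) * p * u ^- (2 * j + o'))%g.
    by rewrite /sig /p !mulgA.
  suff : 4 * Z <= l p + 4 * C + 8 * C + 4 * D.
    by have := length_sandwich (u ^+ (2 * i + ~~ o))%g p (u ^- (2 * j + o'))%g; group_lia.
  apply: four_syllables; last lia.
    by move=> m; rewrite !inE => /or4P[] /eqP->.
  move=> y; rewrite !inE => /or3P[] /eqP->; [exact: goodho | | exact: goodho].
  by apply: goodu => //; lia.
exists M, (generated S); split=> [|i ik|x]; first exact: generated_subgroup.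
  apply: sub_generated; exists i, true; split=> //.
  by rewrite /sig /h /e /= addn0 addn1 !mulgA.
have SV s : S s -> S s^-1%g.
  by move=> [i [o [ik ->]]]; exists i, (~~ o); rewrite sigV.
case/(generated_long SV) => [||[s [i [o [ik ->]]] lsx]]; [|by left|]; last first.
  by right; have := sig_len i o ik; lia.
split=> [s [i [o [ik ->]]]|s t [i [o [ik ->]]] [j [o' [jk ->]]]].
  by have := sig_len i o ik; lia.
have [->|] := sig_mul i o j o' ik jk; [by left | right].
by have := sig_len i o ik; have := sig_len j o' jk; group_lia.
Qed.

End PingPong.

(** * Frattini subgroups *)

Section FrattiniSubgroup.
Context {G : groupType}.
Implicit Types (H K M A : set G) (F : set (set G)).

Lemma chain_finite_subset F (s : seq G) : total_on F subset -> F !=set0 ->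
    (forall x, x \in s -> exists2 A, F A & A x) ->
  exists2 A, F A & forall x, x \in s -> A x.
Proof.
move=> totF [A0 FA0]; elim: s => [|x s IH] Hs; first by exists A0.
have [|A FA As] := IH; first by move=> y ys; apply: Hs; rewrite inE ys orbT.
have [B FB Bx] := Hs x (mem_head _ _).
case: (totF _ _ FA FB) => sub; [exists B | exists A] => // y; rewrite inE.
  by move=> /orP[/eqP->//|/As/sub].
by move=> /orP[/eqP->|/As//]; apply: sub.
Qed.

(** A union of a chain of proper subgroups of H is proper, for otherwise one
    member of the chain would contain the finitely many generators of H. *)
Lemma exists_maximal_subgroup H K : finitely_generated H -> proper_subgroup K H ->
  exists2 M, maximal_subgroup M H & K `<=` M.
Proof.
move=> [S [/finite_seqP[s ->] sH]] [sgK KH].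
have notin A : subgroup A -> A `<` H -> exists2 x, x \in s & ~ A x.
  move=> sgA [_ nHA]; apply: contrapT => nx; apply: nHA.
  rewrite -sH; apply: generated_sub => // x xs; apply: contrapT => nAx.
  by apply: nx; exists x.
(* the empty set is admitted as the union of the empty chain *)
pose P := [set A : set G | A = set0 \/ proper_subgroup A H /\ K `<=` A].
have K1 := subgroup1 sgK.
have [|M [PM maxM]] := @Zorn_bigcup _ P.
  move=> F FP totF; pose F' := [set A | F A /\ A !=set0].
  have F'P A : F' A -> proper_subgroup A H /\ K `<=` A.
    by move=> [/FP[->[x []]|//]].
  have [[A0 FA0]|nF'] := pselect (F' !=set0); last first.
    left; rewrite -subset0 => x [A FA Ax]; apply: nF'.
    by exists A; split=> //; exists x.
  right; have [_ KA0] := F'P _ FA0.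
  have totF' : total_on F' subset by move=> A B [FA _] [FB _]; apply: totF.
  have mem x : (\bigcup_(X in F) X) x -> exists2 A, F' A & A x.
    by move=> [A FA Ax]; exists A => //; split=> //; exists x.
  split; last by move=> x Kx; exists A0; [case: FA0 | apply: KA0].
  have sgU : subgroup (\bigcup_(X in F) X).
    apply/subgroupP; split=> [|x y /mem[A FA Ax] /mem[B FB By]].
      by exists A0; [case: FA0 | apply: KA0].
    have [[[sgA _] _] [[sgB _] _]] := (F'P _ FA, F'P _ FB).
    case: (totF' _ _ FA FB) => sub.
      exists B; first by case: FB.
      by apply: subgroupM => //; [apply: sub | apply: subgroupV].
    exists A; first by case: FA.
    by apply: subgroupM => //; apply: subgroupV => //; apply: sub.
  split=> //; split=> [x /mem[A /F'P[[_ [AH _]] _] Ax]|HU]; first exact: AH.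
  have [|A FA As] := @chain_finite_subset F' s totF' (ex_intro _ A0 FA0).
    by move=> x xs; apply: mem; apply: HU; rewrite -sH; apply: sub_generated.
  have [[sgA AH] _] := F'P _ FA.
  by have [x xs] := notin A sgA AH; apply; apply: As.
case: PM maxM => [->|[prM KM]] maxM.
  have K0 : set0 `<` K by split=> // K0; apply: (K0 _ K1).
  by case: (maxM K K0); right; split=> //; split.
exists M => //; split=> // B prB MB; case: (maxM B MB).
by right; split=> //; apply: subset_trans KM _; case: MB.
Qed.

Lemma Frattini_sub_maximal H M : maximal_subgroup M H -> Frattini H `<=` M.
Proof.
move=> maxM; rewrite /Frattini asboolT; last by exists M.
by move=> x; apply.
Qed.

Lemma Frattini_ind H x : subgroup H -> H x ->
  (forall M, maximal_subgroup M H -> M x) -> Frattini H x.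
Proof. by rewrite /Frattini; case: ifP => // _ _ _ HM M /HM. Qed.

Lemma Frattini_sub H : Frattini H `<=` H.
Proof.
rewrite /Frattini; case: ifP => [/asboolP[M maxM] x /(_ M maxM)|_ //].
by case: maxM => -[_ [MH _]] _ /MH.
Qed.

Lemma Frattini_subgroup H : subgroup H -> subgroup (Frattini H).
Proof.
move=> sgH; apply/subgroupP; split=> [|x y Fx Fy].
  apply: Frattini_ind => // [|M [[sgM _] _]]; exact: subgroup1.
apply: Frattini_ind => // [|M maxM].
  by apply: subgroupM => //; [|apply: subgroupV => //]; apply: Frattini_sub.
have [[sgM _] _] := maxM; apply: subgroupM => //; last apply: subgroupV => //.
  exact: Frattini_sub_maximal Fx.
exact: Frattini_sub_maximal Fy.
Qed.

Lemma Frattini_nongenerators H K : finitely_generated H -> proper_subgroup K H ->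
  exists M, [/\ proper_subgroup M H, K `<=` M & Frattini H `<=` M].
Proof.
move=> fgH prK; have [M maxM KM] := exists_maximal_subgroup fgH prK.
by exists M; split=> //; [case: maxM | apply: Frattini_sub_maximal].
Qed.

Let conj h A : set G := [set x | A (h * x * h^-1)%g].

Let conj_proper H A h : subgroup H -> H h ->
  proper_subgroup A H -> proper_subgroup (conj h A) H.
Proof.
move=> sgH Hh [sgA [AH HA]]; have HV := subgroupV sgH Hh; split.
  apply/subgroupP; split=> [|x y Ax Ay].
    by rewrite /conj /= !gnorm; apply: subgroup1.
  rewrite /conj /=.
  have -> : (h * (x * y^-1) * h^-1 = (h * x * h^-1) * (h * y * h^-1)^-1)%g.
    by rewrite !gnorm.
  by apply: subgroupM => //; apply: subgroupV.
split=> [x /AH Hx|HA']; last first.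
  apply: HA => x Hx; have := HA' (h^-1 * x * h)%g; rewrite /conj /= !gnorm; apply.
  by apply: subgroupM => //; apply: subgroupM.
have -> : (x = h^-1 * (h * x * h^-1) * h)%g by rewrite !gnorm.
by apply: subgroupM => //; apply: subgroupM.
Qed.

(** Conjugation by h permutes the maximal subgroups of H. *)
Lemma Frattini_conj H h x : subgroup H -> H h -> Frattini H x ->
  Frattini H (h * x * h^-1)%g.
Proof.
move=> sgH Hh Fx; have HV := subgroupV sgH Hh.
have Hx := Frattini_sub Fx; apply: Frattini_ind => // [|M [prM maxM]].
  by apply: subgroupM => //; apply: subgroupM.
apply: (@Frattini_sub_maximal H (conj h M)) => //.
split=> [|K prK [MK KM]]; first exact: conj_proper.
have conjKV A y : conj h^-1%g A (h * y * h^-1)%g = A y by rewrite /conj /= !gnorm.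
apply: (maxM (conj h^-1%g K)); first exact: conj_proper.
split=> [y My|KM'].
  by apply: MK; rewrite /conj /= !gnorm.
by apply: KM => y Ky; apply: KM'; rewrite conjKV.
Qed.

End FrattiniSubgroup.

(** * A supplement of a normal infinite cyclic subgroup *)

Section Transfer.
Context {G : groupType}.
Implicit Types (x y z g h t : G).

(** Write Z for the group generated by z and T for a transversal of Z in H, with
    q elements, and write each x in H as z^(n x) rep x with rep x in T. The
    function phi g, the sum of the n (g t) over T, is the transfer. As H
    permutes T modulo Z, it satisfies phi (g h) = (+/-) phi h + phi g, and
    phi (z^k g) = q k + phi g. So the elements g such that q + 1 divides phi g
    form a subgroup; it contains z^(phi h) h for each h in H because
    q phi h + phi h is divisible by q + 1, and it does not contain z because
    phi z = q. *)
Lemma normal_cyclic_supplement (H T0 : set G) z :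
    subgroup H -> H z -> (forall p q, zpow z p = zpow z q -> p = q) ->
    (forall h, H h -> preserves z h) ->
    finite_set T0 -> (forall h, H h -> exists k, T0 (h * zpow z k)%g) ->
  exists K, [/\ subgroup K, K `<=` H, ~ K z &
    forall h, H h -> exists k, K (zpow z k * h)%g].
Proof.
move=> sgH Hz inj Pz finT0 HT0.
pose rep x : G := xget 1%g [set y | exists k, y = (zpow z k * x)%g].
have rep_coset x k : rep (zpow z k * x)%g = rep x.
  rewrite /rep; congr xget; apply/seteqP; split=> y [j ->].
    by exists (j + k)%R; rewrite zpowD mulgA.
  by exists (j - k)%R; rewrite zpowD zpowN mulgA mulgVK.
have ex_n x : exists k, x = (zpow z k * rep x)%g.
  have [k Hk] : exists k, rep x = (zpow z k * x)%g.
    have ex : [set y | exists k, y = (zpow z k * x)%g] !=set0.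
      by exists x, 0%R; rewrite mul1g.
    exact: (xgetPex 1%g ex).
  by exists (- k)%R; rewrite Hk zpowN mulKg.
have [n Hn] := choice ex_n.
have nz x k : n (zpow z k * x)%g = (k + n x)%R.
  apply: inj; apply: (mulIg (rep x)); rewrite /= zpowD -mulgA -Hn.
  by rewrite -(rep_coset x k) -Hn.
have Hzk k : H (zpow z k) by apply: subgroup_zpow.
have Hrep x : H x -> H (rep x).
  move=> Hx; have -> : (rep x = zpow z (- n x) * x)%g by rewrite zpowN {3}(Hn x) mulKg.
  exact: subgroupM.
have /finite_seqP[s0 Es0] : finite_set (rep @` H).
  apply: sub_finite_set (finite_image rep finT0) => _ [h Hh <-].
  have [k T0k] := HT0 h Hh; exists (h * zpow z k)%g => //.
  by have [e ->] := preserves_sign (Pz _ Hh); rewrite rep_coset.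
pose T := undup s0; have uT : uniq T by apply: undup_uniq.
have memT t : t \in T <-> exists2 h, H h & rep h = t.
  by rewrite mem_undup; have /= <- : (rep @` H) t = (t \in s0) by rewrite Es0.
have repK x : rep (rep x) = rep x by rewrite {2}(Hn x) rep_coset.
have HT t : t \in T -> H t by move=> /memT[h Hh <-]; apply: Hrep.
have repT t : t \in T -> rep t = t by move=> /memT[h _ <-].
have n0 t : t \in T -> n t = 0%R.
  by move=> tT; apply: inj; apply: (mulIg t); rewrite /= mul1g -{2}(repT t tT) -Hn.
pose phi g : int := (\sum_(t <- T) n (g * t)%g)%R.
have permT h : H h -> perm_eq [seq rep (h * t)%g | t <- T] T.
  move=> Hh; have sub : {subset [seq rep (h * t)%g | t <- T] <= T}.
    move=> _ /mapP[t tT ->]; apply/memT; exists (h * t)%g => //.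
    by apply: subgroupM => //; apply: HT.
  have inj_rep : {in T &, injective (fun t => rep (h * t)%g)}.
    move=> t t' tT t'T /= e; rewrite -(repT t tT) -(repT t' t'T).
    have [k ht] : exists k, (h * t = zpow z k * (h * t'))%g.
      exists (n (h * t)%g - n (h * t')%g)%R.
      have e' : rep (h * t')%g = ((zpow z (n (h * t')%g))^-1 * (h * t'))%g.
        by apply: (mulgI (zpow z (n (h * t')%g))); rewrite /= mulVKg -Hn.
      by rewrite zpowD zpowN -mulgA -e' -e -Hn.
    have [e' He'] := preserves_sign (Pz _ (subgroupV sgH Hh)).
    have -> : t = (h^-1 * (h * t))%g by rewrite mulKg.
    by rewrite ht mulgA He' -mulgA mulKg rep_coset.
  apply: uniq_perm => //; first by rewrite map_inj_in_uniq.
  have [||//] := uniq_min_size _ sub; first by rewrite map_inj_in_uniq.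
  by rewrite size_map.
have phi_cross g h : H g -> H h ->
    exists e : bool, phi (g * h)%g = ((if e then phi h else - phi h) + phi g)%R.
  move=> Hg Hh; have [e He] := preserves_sign (Pz _ Hg); exists e.
  have -> : phi g = (\sum_(t <- T) n (g * rep (h * t)%g)%g)%R.
    by rewrite /phi -(perm_big _ (permT h Hh)) big_map.
  have -> : (if e then phi h else - phi h)%R =
      (\sum_(t <- T) (if e then n (h * t)%g else - n (h * t)%g))%R.
    by case: (e); rewrite // /phi sumrN.
  rewrite -big_split /=; apply: eq_bigr => t _.
  by rewrite -mulgA {1}(Hn (h * t)%g) mulgA He -mulgA nz.
have phiz k g : phi (zpow z k * g)%g = ((size T)%:Z * k + phi g)%R.
  rewrite /phi (eq_bigr (fun t => k + n (g * t)%g)%R); last first.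
    by move=> t _; rewrite -mulgA nz.
  by rewrite big_split /= big_const_seq count_predT iter_addr_0 mulrC -mulr_natr natz.
have phi1 : phi 1%g = 0%R.
  by rewrite /phi big_seq big1 // => t tT; rewrite mul1g n0.
pose q := size T; have q0 : 0 < q.
  rewrite /q; case: (T) (memT (rep 1%g)) => // -[_ H0].
  by have := H0 (ex_intro2 _ _ 1%g (subgroup1 sgH) erefl).
have sgK : subgroup [set g | H g /\ (q.+1%:Z %| phi g)%Z].
  apply/subgroupP; split=> [|g h [Hg dg] [Hh dh]].
    by split; [apply: subgroup1 | rewrite phi1].
  have HhV := subgroupV sgH Hh; split; first exact: subgroupM.
  have [e ->] := phi_cross g h^-1%g Hg HhV.
  apply: rpredD => //; suff dhV : (q.+1%:Z %| phi h^-1%g)%Z by case: e; rewrite ?rpredN.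
  have [e' E] := phi_cross h h^-1%g Hh HhV; move: E; rewrite mulgV phi1 => E.
  have -> : phi h^-1%g = (if e' then - phi h else phi h)%R by case: e' E => /=; lia.
  by case: e' {E}; rewrite ?rpredN.
exists [set g | H g /\ (q.+1%:Z %| phi g)%Z]; split=> // [g []//|[_]|h Hh].
  rewrite -[z]mulg1 -[z in (z * _)%g]/(zpow z 1) phiz phi1 addr0 mulr1.
  by rewrite dvdzE !absz_nat gtnNdvd // ltnS.
exists (phi h); split; first exact: subgroupM.
have -> : phi (zpow z (phi h) * h)%g = (q.+1%:Z * phi h)%R.
  by rewrite phiz -/q -addn1 PoszD mulrDl mul1r.
exact: dvdz_mulr.
Qed.
End Transfer.

(** * Finiteness for hyperbolic lengths *)

Section FiniteFrattini.
Context {G : groupType} {l : G -> nat} {D : nat} (hyp : hyperbolic_length l D).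
Implicit Types (x y z g h u v : G) (H K : set G).

Local Notation loxodromic := (loxodromic l).

(** The supplement K of z given by [normal_cyclic_supplement] is a proper subgroup
    of H that generates H together with the non-generator z. *)
Lemma Frattini_no_preserved_loxodromic H z : finitely_generated H -> subgroup H ->
  Frattini H z -> loxodromic z -> ~ (forall h, H h -> preserves z h).
Proof.
move=> fgH sgH Fz lz Pz; have Hz := Frattini_sub Fz.
have [B HB] := preserving_coset_bounded hyp lz.
have [|K [sgK KH Kz HK]] := normal_cyclic_supplement sgH Hz
    (fun p q => @loxodromic_zpow_inj _ _ _ hyp z p q lz) Pz (finite_ball hyp B).
  by move=> h /Pz/HB.
have prK : proper_subgroup K H by split=> //; split=> // HK'; apply/Kz/HK'.
have [M [[sgM [MH HM]] KM FM]] := Frattini_nongenerators fgH prK.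
apply: HM => h Hh; have [k Kk] := HK h Hh.
have -> : (h = zpow z (- k) * (zpow z k * h))%g by rewrite zpowN mulKg.
by apply: subgroupM => //; [apply: subgroup_zpow => //; apply: FM | apply: KM].
Qed.

(** If u^c were in the commensurator of v, then infinitely many powers of u^c
    would preserve a power of v and so lie in finitely many cosets of its cyclic
    group. Then some power of u = k v k^-1 would be a power of v, and k would be
    in the commensurator. *)
Lemma conjugate_powers_not_commensurator v k c : loxodromic v ->
  ~ commensurator v k -> 0 < c -> ~ commensurator v ((k * v * k^-1) ^+ c)%g.
Proof.
move=> lv Nk c0 [n n0 Pu]; apply: Nk; set u := (k * v * k^-1)%g in Pu.
have [B HB] := preserving_coset_bounded hyp (loxodromic_exp n0 lv).
have ex_j i : exists j, l ((u ^+ c) ^+ i * zpow (v ^+ n)%g j)%g <= B.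
  by apply: HB; apply: (subgroupX _ (preserves_subgroup _)).
have [j Hj] := choice ex_j.
have [N HN] := finite_set_repeats (finite_ball hyp B).
have [i _|i [i' [/andP[ii' _] e]]] :=
  HN (fun i => ((u ^+ c) ^+ i * zpow (v ^+ n)%g (j i))%g); first exact: Hj.
have E : (k * zpow v (c * (i' - i))%N * k^-1 = zpow v (n%:Z * (j i - j i')))%g.
  rewrite zpow_conj -/u zpowM (_ : zpow v n = v ^+ n)%g // zpowD zpowN /=.
  rewrite expgnA expgnFr ?(ltnW ii') //.
  apply: (mulgI ((u ^+ c) ^+ i)%g); apply: (mulIg (zpow (v ^+ n)%g (j i'))).
  rewrite /= [in RHS]mulgA mulgVK e; congr (_ * _)%g.
  by rewrite -!expgnFr ?(ltnW ii') // -expgnDr subnKC ?(ltnW ii').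
apply: (commensurator_intro hyp lv _ E).
by rewrite eqz_nat muln_eq0 negb_or -!lt0n c0 subn_gt0.
Qed.

Theorem finite_Frattini H : finitely_generated H -> subgroup H ->
  finite_set (Frattini H).
Proof.
move=> fgH sgH; apply: contrapT => infF.
have sgF := Frattini_subgroup sgH.
have [v Fv lv] := infinite_subgroup_loxodromic hyp sgF infF.
have sgE := commensurator_subgroup v.
have [S [/finite_seqP[s ->{S}] sH]] := fgH.
have Hs x : x \in s -> H x by move=> xs; rewrite -sH; apply: sub_generated.
have [Es|] := pselect (forall x, x \in s -> commensurator v x).
  have [n n0 Hn] := commensurator_uniform Es.
  apply: (Frattini_no_preserved_loxodromic fgH sgH _ (loxodromic_exp n0 lv)).
    exact: subgroupX.
  move=> h; rewrite -sH => /generated_sub; apply; last exact: Hn.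
  exact: preserves_subgroup.
move=> /existsNP[k /not_implyP[ks Nk]].
pose u := (k * v * k^-1)%g.
have Fu : Frattini H u by apply: Frattini_conj => //; apply: Hs.
have Nu c : 0 < c -> ~ commensurator v (u ^+ c)%g.
  exact: conjugate_powers_not_commensurator.
(* of h and h u, which agree modulo F, one is outside the commensurator *)
pose shift h := if `[< commensurator v h >] then (h * u)%g else h.
have Nshift h : h \in map shift s -> ~ commensurator v h.
  move=> /mapP[x _ ->]; rewrite /shift; case: ifPn => /asboolP // Ex Exu.
  apply: (Nu 1) => //; rewrite expg1 -(mulKg x u).
  by apply: subgroupM => //; apply: subgroupV.
have [N HN] := @uniform_bound _ (fun x n => l x <= n) s
  (fun x m n mn le => leq_trans le mn) (fun x _ => ex_intro _ (l x) (leqnn _)).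
have [M [K [sgK Kg Klong]]] := ping_pong_subgroup hyp N lv Nshift Nu.
have prK : proper_subgroup (K `&` H) H.
  split.
    apply/subgroupP; split=> [|x y [Kx Hx] [Ky Hy]]; first by split; apply: subgroup1.
    by split; apply: subgroupM => //; apply: subgroupV.
  split=> [x []//|HK]; have [Kk _] := HK k (Hs k ks).
  case: (Klong k Kk) => [k1|]; last by rewrite ltnNge HN.
  by apply: Nk; rewrite k1; apply: subgroup1.
have [L [[sgL [LH HL]] KL FL]] := Frattini_nongenerators fgH prK.
apply: HL; rewrite -sH; apply: generated_sub => // x xs.
have Lu := FL _ Fu; have Lv := FL _ Fv.
have Lshift : L (shift x).
  have xm : index x s < size (map shift s) by rewrite size_map index_mem.
  have := Kg _ xm; rewrite (nth_map 1%g) ?index_mem // nth_index //.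
  set a := (_ ^+ (2 * _))%g; set b := (v ^+ M)%g; set c := (_ ^+ _.+1)%g => Kx.
  have La : L a by apply: subgroupX.
  have Lb : L b by apply: subgroupX.
  have Lc : L c by apply: subgroupX.
  have Hshift : H (shift x).
    have Hx := Hs _ xs; rewrite /shift; case: ifP => // _.
    by apply: subgroupM => //; apply: LH.
  have Lx : L (a * b * shift x * b * c^-1)%g.
    apply: KL; split=> //.
    by do !apply: subgroupM => //; try apply: LH; try apply: subgroupV.
  have -> : (shift x = b^-1 * a^-1 * (a * b * shift x * b * c^-1) * c * b^-1)%g.
    by rewrite !gnorm.
  by do !apply: subgroupM => //; apply: subgroupV.
move: Lshift; rewrite /shift; case: ifP => // _ Lxu.
by rewrite -(mulgK u x); apply: subgroupM => //; apply: subgroupV.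
Qed.
End FiniteFrattini.

(** * Word length *)

Section WordLength.
Context {G : groupType} (S : set G).
Implicit Types (x y z g h : G) (w : seq G).

Definition word w : Prop := forall x, x \in w -> S x \/ S x^-1%g.

Definition wordprod w : G := foldr (fun x y => x * y)%g 1%g w.

Lemma wordprod_cat w1 w2 : wordprod (w1 ++ w2) = (wordprod w1 * wordprod w2)%g.
Proof. by elim: w1 => [|x w IH] /=; rewrite ?mul1g // IH mulgA. Qed.

Lemma word_cat w1 w2 : word w1 -> word w2 -> word (w1 ++ w2).
Proof. by move=> H1 H2 x; rewrite mem_cat => /orP[/H1|/H2]. Qed.

Lemma word_take w i : word w -> word (take i w).
Proof. by move=> H x /mem_take/H. Qed.

Lemma word_drop w i : word w -> word (drop i w).
Proof. by move=> H x /mem_drop/H. Qed.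

Lemma word_inv w : word w ->
  exists w', [/\ word w', wordprod w' = (wordprod w)^-1%g & size w' = size w].
Proof.
elim: w => [|x w IH] H; first by exists [::]; rewrite /= invg1.
have [|w' [W' P' S']] := IH; first by move=> y yw; apply: H; rewrite inE yw orbT.
exists (w' ++ [:: x^-1%g]); split; last by rewrite size_cat S' addn1.
  apply: word_cat => // y; rewrite inE => /eqP->; rewrite invgK.
  by case: (H x (mem_head _ _)); [right | left].
by rewrite wordprod_cat P' /= mulg1 invgM.
Qed.

Definition word_length g : nat := xget 0
  [set n | edge_path_lengths S 1%g g n /\
           forall m, edge_path_lengths S 1%g g m -> n <= m].

Lemma edge_path_lengthsP g h n : edge_path_lengths S g h n <->
  exists w, [/\ word w, wordprod w = (g^-1 * h)%g & size w = n].
Proof.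
split=> [[w [W <-] <-]|[w [W P <-]]]; exists w => //; first by rewrite mulKg.
by split=> //; rewrite -[foldr _ _ _]/(wordprod w) P mulVKg.
Qed.

Context (genS : generated S = setT).

Lemma word_exists g : exists2 w, word w & wordprod w = g.
Proof.
have : generated S g by rewrite genS.
suff /[apply] : generated S `<=` [set g | exists2 w, word w & wordprod w = g] by [].
apply: generated_translate => [|s x Ss [w W <-]]; first by exists [::].
have cons t : S t \/ S t^-1%g -> exists2 w', word w' & wordprod w' = (t * wordprod w)%g.
  move=> St; exists (t :: w) => // y; rewrite inE => /orP[/eqP->//|]; exact: W.
by split; apply: cons; rewrite ?invgK; [left | right].
Qed.

Lemma word_length_spec g : edge_path_lengths S 1%g g (word_length g) /\
  forall m, edge_path_lengths S 1%g g m -> word_length g <= m.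
Proof.
pose P n := `[< edge_path_lengths S 1%g g n >].
have exP : exists n, P n.
  have [w W wg] := word_exists g; exists (size w); apply/asboolP/edge_path_lengthsP.
  by exists w; rewrite invg1 mul1g.
case: (ex_minnP exP) => n /asboolP en nmin.
have min_n : [set n | edge_path_lengths S 1%g g n /\
    forall m, edge_path_lengths S 1%g g m -> n <= m] !=set0.
  by exists n; split=> // m em; apply: nmin; apply/asboolP.
exact: (xgetPex 0 min_n).
Qed.

Lemma word_lengthP g :
  exists w, [/\ word w, wordprod w = g & size w = word_length g].
Proof.
have [/edge_path_lengthsP[w]] := word_length_spec g.
by rewrite invg1 mul1g => -[W wg sw] _; exists w.
Qed.

Lemma word_length_min w : word w -> word_length (wordprod w) <= size w.
Proof.
move=> W; apply: (word_length_spec _).2; apply/edge_path_lengthsP.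
by exists w; rewrite invg1 mul1g.
Qed.

Lemma edge_path_lengths_min g h n :
  edge_path_lengths S g h n -> dist word_length g h <= n.
Proof. by move=> /edge_path_lengthsP[w [W P <-]]; rewrite /dist -P word_length_min. Qed.

Lemma edge_path_lengths_dist g h : edge_path_lengths S g h (dist word_length g h).
Proof. exact/edge_path_lengthsP/word_lengthP. Qed.

Lemma word_length1 : word_length 1%g = 0.
Proof. by apply/eqP; rewrite -leqn0 (@word_length_min [::]). Qed.

Lemma word_length_eq0 g : word_length g = 0 -> g = 1%g.
Proof. by have [w [_ <- <-]] := word_lengthP g; case: w. Qed.

Lemma word_lengthV g : word_length g^-1%g = word_length g.
Proof.
have le x : word_length x^-1%g <= word_length x.
  have [w [W <- <-]] := word_lengthP x; have [w' [W' <- <-]] := word_inv W.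
  exact: word_length_min.
by apply/eqP; rewrite eqn_leq le -{1}(invgK g) le.
Qed.

Lemma word_lengthM x y : word_length (x * y)%g <= word_length x + word_length y.
Proof.
have [w1 [W1 <- <-]] := word_lengthP x; have [w2 [W2 <- <-]] := word_lengthP y.
by rewrite -wordprod_cat -size_cat; apply/word_length_min/word_cat.
Qed.

Lemma word_length_ball n : finite_set S -> finite_set [set g | word_length g <= n].
Proof.
move=> finS; pose L := S `|` [set x | S x^-1%g].
have finL : finite_set L.
  rewrite finite_setU; split=> //.
  apply: sub_finite_set (finite_image (fun x => x^-1)%g finS) => x Sx.
  by exists x^-1%g; rewrite ?invgK.
elim: n => [|n IH].
  apply: (sub_finite_set _ (finite_set1 1%g)) => g.
  by rewrite /= leqn0 => /eqP/word_length_eq0.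
pose B := [set g | word_length g <= n].
have fin2 : finite_set ([set 1%g] `|` [set (x * y)%g | x in L & y in B]).
  by rewrite finite_setU; split; [apply: finite_set1 | apply: finite_image2].
apply: sub_finite_set fin2 => g /=.
have [[|x w] [W <- <-] sw] := word_lengthP g; [by left | right].
exists x; first by apply: W; apply: mem_head.
exists (wordprod w) => //; apply: (leq_trans (word_length_min _)); last exact: sw.
by move=> y yw; apply: W; rewrite inE yw orbT.
Qed.

Definition geodesic_word w := word w /\ size w = word_length (wordprod w).

Lemma dist_prefixes w i j : geodesic_word w -> i <= j -> j <= size w ->
  dist word_length (wordprod (take i w)) (wordprod (take j w)) = j - i.
Proof.
move=> [W sw] ij jw; set m := drop i (take j w).
have ew : w = take i w ++ m ++ drop j w.
  by rewrite catA -{1}(take_takel w ij) cat_take_drop cat_take_drop.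
have ej : take j w = take i w ++ m by rewrite -{1}(take_takel w ij) cat_take_drop.
have Wi : word (take i w) by exact: word_take.
have Wj : word (drop j w) by exact: word_drop.
have Wm : word m by apply/word_drop/word_take.
have -> : dist word_length (wordprod (take i w)) (wordprod (take j w)) =
    word_length (wordprod m) by rewrite ej wordprod_cat /dist mulKg.
have sm : size m = j - i by rewrite size_drop size_takel.
have := word_length_min Wi; have := word_length_min Wj; have := word_length_min Wm.
have := word_lengthM (wordprod (take i w)) (wordprod m * wordprod (drop j w))%g.
have := word_lengthM (wordprod m) (wordprod (drop j w)).
rewrite -!wordprod_cat -ew -sw sm size_drop (size_takel (leq_trans ij jw)); lia.
Qed.

Lemma geodesic_word_exists g h :
  exists2 w, geodesic_word w & (g * wordprod w)%g = h.
Proof.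
have [w [W P sw]] := word_lengthP (g^-1 * h)%g.
by exists w; [split; rewrite ?P | rewrite P mulVKg].
Qed.

Lemma word_length_split x t : t <= word_length x ->
  exists p, word_length p = t /\ word_length (p^-1 * x)%g = word_length x - t.
Proof.
have [w gw] := geodesic_word_exists 1%g x; rewrite mul1g => wx.
have [_ sw] := gw; rewrite wx in sw; rewrite -sw => tw.
exists (wordprod (take t w)); split.
  by have := dist_prefixes gw (leq0n t) tw; rewrite take0 /= dist1x subn0.
by have := dist_prefixes gw tw (leqnn _); rewrite take_size wx.
Qed.
End WordLength.

(** * Geodesics of the Cayley graph *)

Lemma inf_min (R : realType) (E : set R) c : E c -> lbound E c -> inf E = c.
Proof.
move=> Ec lb; apply/eqP; rewrite eq_le; apply/andP; split.
  by apply: ge_inf => //; exists c.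
by apply: lb_le_inf => //; exists c.
Qed.

Section CayleyPaths.
Context {R : realType} {G : groupType} {S : set G}.
Context (genS : generated S = setT).
Implicit Types (g h x y z : G) (w : seq G) (r s t : R).

Local Notation d := (dist (word_length S)).
Local Notation cayley_point := (@cayley_point R G).

Definition vertex g w i : G := (g * wordprod (take i w))%g.

Lemma vertex0 g w : vertex g w 0 = g.
Proof. by rewrite /vertex take0 mulg1. Qed.

Lemma vertex_size g w : vertex g w (size w) = (g * wordprod w)%g.
Proof. by rewrite /vertex take_size. Qed.

Lemma vertexS g w i : i < size w -> vertex g w i.+1 = (vertex g w i * nth 1 w i)%g.
Proof.
move=> iw; rewrite /vertex (take_nth 1%g) // -cats1 wordprod_cat /= mulg1.
by rewrite mulgA.
Qed.

Lemma vertex_dist g w i j : geodesic_word S w -> i <= j -> j <= size w ->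
  d (vertex g w i) (vertex g w j) = j - i.
Proof. by move=> gw ij jw; rewrite dist_mull; apply: dist_prefixes. Qed.

Lemma vertex_inj g w i j : geodesic_word S w -> i <= size w -> j <= size w ->
  vertex g w i = vertex g w j -> i = j.
Proof.
move=> gw; wlog ij : i j / i <= j.
  by move=> H iw jw e; have [/H->|/ltnW/H->] := leqP i j.
move=> iw jw e; have := vertex_dist g gw ij jw.
by rewrite e /dist mulVg word_length1 //; lia.
Qed.

(** The path of unit speed that reads off w from g, where a letter s with S s^-1
    but not S s runs backwards along the edge labelled s^-1. *)
Definition path_point g w t : cayley_point :=
  let i := Num.truncn t in
  if t == i%:R%R then Vertex (vertex g w i)
  else if `[< S (nth 1%g w i) >]
    then Edge_point (vertex g w i) (nth 1%g w i) (t - i%:R)%R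
    else Edge_point (vertex g w i.+1) (nth 1%g w i)^-1%g (i.+1%:R - t)%R.

Variant path_point_spec g w t : cayley_point -> Prop :=
| AtVertex i of i <= size w & t = i%:R%R :
    path_point_spec g w t (Vertex (vertex g w i))
| AlongEdge i of i < size w & (i%:R < t < i.+1%:R)%R & S (nth 1%g w i) :
    path_point_spec g w t (Edge_point (vertex g w i) (nth 1%g w i) (t - i%:R)%R)
| AgainstEdge i of i < size w & (i%:R < t < i.+1%:R)%R & ~ S (nth 1%g w i) &
    S (nth 1%g w i)^-1%g :
    path_point_spec g w t
      (Edge_point (vertex g w i.+1) (nth 1%g w i)^-1%g (i.+1%:R - t)%R).

Lemma path_pointP g w t : word S w -> (0 <= t <= (size w)%:R)%R ->
  path_point_spec g w t (path_point g w t).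
Proof.
move=> W /andP[t0 tw]; rewrite /path_point; set i := Num.truncn t.
have /andP[it ti] := truncn_itv t0; rewrite -/i in it ti.
case: eqVneq => [e|ne].
  by constructor=> //; move: tw; rewrite e ler_nat.
have {}it : (i%:R < t)%R by rewrite lt_neqAle eq_sym ne.
have iw : i < size w by rewrite -(ltr_nat R); apply: lt_le_trans it tw.
case: ifP => /asboolP Si; first by constructor=> //; rewrite it.
constructor=> //; first by rewrite it.
by case: (W _ (mem_nth 1%g iw)).
Qed.

Lemma path_point_vertex g w i : path_point g w i%:R%R = Vertex (vertex g w i).
Proof. by rewrite /path_point natrK eqxx. Qed.

Lemma path_point_mem g w t : word S w -> (0 <= t <= (size w)%:R)%R ->
  cayley_graph S (path_point g w t).
Proof.
move=> W tw; case: (path_pointP g W tw) => // i iw /andP[it ti] Si; last move=> SiV;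
  rewrite /cayley_graph /= ; split=> //; rewrite -(natr1 i) in ti *; lra.
Qed.

(** Leaving the point at time t through a vertex of the path costs at least the
    time between the two, so that lower bounds for the distances between points
    of the path follow from the distances between its vertices. *)
Lemma path_point_exits g w t (a : G * R) : word S w ->
    (0 <= t <= (size w)%:R)%R -> exits (path_point g w t) a ->
  exists i, [/\ i <= size w, a.1 = vertex g w i, (t - i%:R <= a.2)%R &
                (i%:R - t <= a.2)%R].
Proof.
move=> W tw.
case: (path_pointP g W tw) => [i iw ->|i iw /andP[it ti] _|i iw /andP[it ti] _ _].
- by move=> /= ->; exists i; split=> //=; rewrite subrr.
- rewrite -natr1 in ti; move=> /= [] ->.
    by exists i; split=> //=; [exact: ltnW | lra].
  by exists i.+1; split=> //=; rewrite ?vertexS -?natr1 //; lra.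
- have e : (vertex g w i.+1 * (nth 1 w i)^-1 = vertex g w i)%g.
    by rewrite vertexS // mulgK.
  rewrite -natr1 in ti *; move=> /= [] ->; rewrite /= ?e.
    by exists i.+1; split=> //=; rewrite -?natr1; lra.
  by exists i; split=> //=; [exact: ltnW | lra | lra].
Qed.

Definition cayley_lengths (p q : cayley_point) : set R :=
  lengths_through_vertices S p q `|` lengths_inside_edge p q.

Lemma edge_path_lengths_sym g h n :
  edge_path_lengths S g h n -> edge_path_lengths S h g n.
Proof.
move=> /edge_path_lengthsP[w [W P <-]]; have [w' [W' P' <-]] := word_inv W.
by apply/edge_path_lengthsP; exists w'; split=> //; rewrite P' P invgM invgK.
Qed.

Lemma cayley_lengths_sym p q c : cayley_lengths p q c -> cayley_lengths q p c.
Proof.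
case=> [[a [b [n [pa qb nab ->]]]]|[g [s [t [r [-> -> ->]]]]]]; [left | right].
  exists b, a, n; split=> //; first exact: edge_path_lengths_sym.
  by rewrite addrC addrA addrAC.
by exists g, s, r, t; split=> //; rewrite distrC.
Qed.

Lemma cayley_lengths_ge g w s t c : geodesic_word S w ->
    (0 <= s <= (size w)%:R)%R -> (0 <= t <= (size w)%:R)%R ->
  cayley_lengths (path_point g w s) (path_point g w t) c -> (s - t <= c)%R.
Proof.
move=> gw sw tw; have [W _] := gw.
case=> [[a [b [n [pa qb nab ->]]]]|[g0 [s0 [t1 [r [es et ->]]]]]].
  have [i [iw ai a1 a2]] := path_point_exits W sw pa.
  have [j [jw bj b1 b2]] := path_point_exits W tw qb.
  have : d (vertex g w i) (vertex g w j) <= n.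
    by rewrite -ai -bj; apply: edge_path_lengths_min.
  have [ij|/ltnW ij] := leqP i j.
    have : (i%:R <= j%:R :> R)%R by rewrite ler_nat.
    have : (0 <= n%:R :> R)%R by rewrite ler0n.
    lra.
  rewrite (_ : d _ _ = i - j); last first.
    by rewrite /dist -word_lengthV // invgM invgK; exact: vertex_dist.
  rewrite leq_subLR -(ler_nat R) natrD; lra.
have inj := vertex_inj (g := g) gw.
(* an edge crossed forwards and an edge crossed backwards are distinct *)
have mixed i j : i < size w -> j < size w -> vertex g w i = vertex g w j.+1 ->
    nth 1%g w i <> (nth 1%g w j)^-1%g.
  move=> iw jw e e'; have ij := inj _ _ (ltnW iw) jw e.
  have : vertex g w i.+1 = vertex g w j by rewrite vertexS // e e' vertexS // mulgK.
  by move/(inj _ _ iw (ltnW jw)); lia.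
move: es et; case: (path_pointP g W sw) => // i iw _ _.
  move=> [ig is0 it]; case: (path_pointP g W tw) => // j jw _ _.
    move=> [jg js0 jr]; rewrite -it -jr.
    have -> : i = j by apply: inj; rewrite ?ig ?jg // ltnW.
    have := ler_norm (s - j%:R - (t - j%:R))%R; lra.
  by move=> _ [jg js0 _]; case: (mixed i j iw jw); rewrite ?ig ?jg ?is0 ?js0.
move=> _ [ig is0 it]; case: (path_pointP g W tw) => // j jw _ _.
  by move=> [jg js0 _]; case: (mixed j i jw iw); rewrite ?ig ?jg ?is0 ?js0.
move=> _ [jg js0 jr]; rewrite -it -jr.
have [->] : i.+1 = j.+1 by apply: inj; rewrite ?ig ?jg.
have := ler_norm (- (j.+1%:R - s - (j.+1%:R - t)))%R; rewrite normrN; lra.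
Qed.

Lemma path_point_floor g w t : word S w -> (0 <= t <= (size w)%:R)%R ->
  exists i, [/\ i <= size w, (i%:R <= t < i.+1%:R)%R &
    exits (path_point g w t) (vertex g w i, (t - i%:R)%R)].
Proof.
move=> W tw.
case: (path_pointP g W tw) => [i iw ->|i iw /andP[it ti] _|i iw /andP[it ti] _ _].
- by exists i; split=> //=; rewrite ?subrr // lexx ltr_nat /=.
- by exists i; split; rewrite ?(ltnW iw) ?(ltW it) //=; left.
- exists i; split; rewrite ?(ltnW iw) ?(ltW it) //=; right.
  by rewrite vertexS // mulgK -natr1; congr (_, _); lra.
Qed.

Lemma path_point_ceil g w t : word S w -> (0 <= t <= (size w)%:R)%R ->
  exists i, [/\ i <= size w, (i%:R - 1 < t <= i%:R)%R &
    exits (path_point g w t) (vertex g w i, (i%:R - t)%R)].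
Proof.
move=> W tw.
case: (path_pointP g W tw) => [i iw ->|i iw /andP[it ti] _|i iw /andP[it ti] _ _].
- by exists i; split=> //=; rewrite ?subrr // lexx andbT; lra.
- exists i.+1; split=> //=; first by rewrite -natr1 in ti *; lra.
  by right; rewrite vertexS // -natr1; congr (_, _); lra.
- exists i.+1; split=> //=; first by rewrite -natr1 in ti *; lra.
  by left.
Qed.

(** Follow the path: from the first vertex not before s to the last vertex not
    after t, if there is one between them. *)
Lemma cayley_lengths_path g w s t : geodesic_word S w ->
    (0 <= s)%R -> (s <= t)%R -> (t <= (size w)%:R)%R ->
  cayley_lengths (path_point g w s) (path_point g w t) (t - s)%R.
Proof.
move=> gw s0 st tn; have [W _] := gw.
have sw : (0 <= s <= (size w)%:R)%R by rewrite s0 (le_trans st).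
have tw : (0 <= t <= (size w)%:R)%R by rewrite tn (le_trans s0).
have [i [iw /andP[is1 is2] ei]] := path_point_ceil g W sw.
have [j [jw /andP[jt1 jt2] ej]] := path_point_floor g W tw.
have [ij|ji] := leqP i j.
  left; exists (vertex g w i, i%:R - s)%R, (vertex g w j, t - j%:R)%R, (j - i).
  split=> //=; last by rewrite natrB //; lra.
  by rewrite -(vertex_dist g gw ij jw); apply: edge_path_lengths_dist.
(* otherwise both points lie in the interior of the edge from vertex j *)
right; have jR : (j.+1%:R <= i%:R :> R)%R by rewrite ler_nat.
rewrite -natr1 in jR jt2.
have unique k (u : R) : (k%:R < u < k.+1%:R)%R -> (j%:R < u < j.+1%:R)%R -> k = j.
  rewrite -!natr1 => k1 j1; have : (k%:R < j%:R + 1 :> R)%R by lra.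
  have : (j%:R < k%:R + 1 :> R)%R by lra.
  by rewrite !natr1 !ltr_nat !ltnS => jk kj; apply/eqP; rewrite eqn_leq kj.
have js : (j%:R < s < j.+1%:R)%R by rewrite -natr1; lra.
have jt : (j%:R < t < j.+1%:R)%R by rewrite -natr1; lra.
have novertex k (u : R) : u = k%:R%R -> (j%:R < u < j.+1%:R)%R -> False.
  by move=> -> /andP[]; rewrite !ltr_nat => jk; rewrite ltnS leqNgt jk.
case: (path_pointP g W sw) =>
  [k _ /novertex/(_ js)//|k _ /unique/(_ js)-> Sj|k _ /unique/(_ js)-> Sj _].
  case: (path_pointP g W tw) =>
    [k' _ /novertex/(_ jt)//|k' _ /unique/(_ jt)-> _|k' _ /unique/(_ jt)-> //].
  exists (vertex g w j), (nth 1%g w j), (s - j%:R)%R, (t - j%:R)%R; split=> //.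
  by rewrite distrC ger0_norm; lra.
case: (path_pointP g W tw) =>
  [k' _ /novertex/(_ jt)//|k' _ /unique/(_ jt)-> //|k' _ /unique/(_ jt)-> _ _].
exists (vertex g w j.+1), (nth 1%g w j)^-1%g, (j.+1%:R - s)%R, (j.+1%:R - t)%R.
split=> //.
by rewrite ger0_norm; lra.
Qed.

Lemma path_point_geodesic g w : geodesic_word S w ->
  geodesic (cayley_graph S) (cayley_dist S) (path_point g w) (size w)%:R%R
    (Vertex g) (Vertex (g * wordprod w)%g).
Proof.
move=> gw; have [W _] := gw; split=> [||| s sw| s t sw tw]; rewrite ?ler0n //.
- by rewrite -[0%R]/(0%:R)%R path_point_vertex vertex0.
- by rewrite path_point_vertex vertex_size.
- exact: path_point_mem.
apply: inf_min; last first.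
  move=> c Ec; rewrite ler_norml; apply/andP; split; last exact: cayley_lengths_ge Ec.
  by have := cayley_lengths_ge gw tw sw (cayley_lengths_sym Ec); lra.
rewrite -/(cayley_lengths _ _).
case/andP: sw => s0 sn; case/andP: tw => t0 tn; case: (lerP s t) => st.
  exact: cayley_lengths_path.
by apply: cayley_lengths_sym; apply: cayley_lengths_path => //; apply: ltW.
Qed.

Lemma path_point_near g h w t (e : R) : geodesic_word S w ->
    (0 <= t <= (size w)%:R)%R ->
    (cayley_dist S (Vertex g) (path_point h w t) <= e)%R ->
  exists2 j, j <= size w & ((d g (vertex h w j))%:R <= e + 1)%R.
Proof.
move=> gw tw le; have [W _] := gw.
have [c Ec ce] : exists2 c,
    cayley_lengths (Vertex g) (path_point h w t) c & (c < e + 1)%R.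
  apply: inf_lt; last by apply: le_lt_trans le _; lra.
  have [i [_ _ ei]] := path_point_floor h W tw.
  eexists; left; exists (g, 0%R), (vertex h w i, t - i%:R)%R; eexists; split=> //=.
  exact: edge_path_lengths_dist.
case: Ec => [[a [b [n [/= -> qb nab e']]]]|[? [? [? [? [//]]]]]].
have [j [jw bj b1 b2]] := path_point_exits W tw qb; exists j => //.
have : d g (vertex h w j) <= n by rewrite -bj; apply: (edge_path_lengths_min genS nab).
rewrite -(ler_nat R) => dn; move: e' => /=; lra.
Qed.

Definition thin_triangles (N : nat) : Prop :=
  forall x y z w1 w2 w3 i,
    geodesic_word S w1 -> geodesic_word S w2 -> geodesic_word S w3 ->
    (x * wordprod w1 = y)%g -> (y * wordprod w2 = z)%g -> (z * wordprod w3 = x)%g ->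
    i <= size w1 ->
    (exists2 j, j <= size w2 & d (vertex x w1 i) (vertex y w2 j) <= N) \/
    (exists2 j, j <= size w3 & d (vertex x w1 i) (vertex z w3 j) <= N).

Lemma delta_hyperbolic_thin_triangles (delta : R) :
    delta_hyperbolic (cayley_graph S) (cayley_dist S) delta ->
  exists N, thin_triangles N.
Proof.
move=> hyp; exists (Num.bound (delta + 1)%R) => x y z w1 w2 w3 i g1 g2 g3 e1 e2 e3 iw.
have seg g w h : geodesic_word S w -> (g * wordprod w = h)%g ->
    geodesic_segment (cayley_graph S) (cayley_dist S)
      (path_point g w @` [set s | 0 <= s <= (size w)%:R]%R) (Vertex g) (Vertex h).
  move=> gw <-; exists (path_point g w), (size w)%:R%R; split=> //.
  exact: path_point_geodesic.
have [near _ _] := hyp _ _ _ _ _ _ (seg _ _ _ g1 e1) (seg _ _ _ g2 e2) (seg _ _ _ g3 e3).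
have [|_ [q qBC dq]] := near (path_point x w1 i%:R%R).
  by exists i%:R%R => //=; rewrite ler0n ler_nat.
rewrite path_point_vertex in dq.
have bound n : (n%:R <= delta + 1)%R -> n <= Num.bound (delta + 1)%R.
  rewrite -(ler_nat R) => le; apply: (le_trans le).
  by apply: ltW; apply: unstable.ltr_bound.
case: qBC dq => -[t tw <-] dq; [left | right].
  by have [j jw /bound] := path_point_near g2 tw dq; exists j.
by have [j jw /bound] := path_point_near g3 tw dq; exists j.
Qed.
End CayleyPaths.

(** * From thin triangles to the four-point inequality *)

Section FourPoint.
Context {G : groupType} {S : set G}.
Context (genS : generated S = setT).
Implicit Types (x y z a : G) (w : seq G).

Local Notation l := (word_length S).
Local Notation d := (dist l).

Let dist_sym x y : d x y = d y x.
Proof. by rewrite /dist -word_lengthV // invgM invgK. Qed.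

Let dist_triangle y x z : d x z <= d x y + d y z.
Proof.
have -> : d x z = l ((x^-1 * y) * (y^-1 * z))%g by rewrite /dist !gnorm.
exact: word_lengthM.
Qed.

Lemma geodesic_vertex_between x w j : geodesic_word S w -> j <= size w ->
  d x (vertex x w j) = j /\ d (vertex x w j) (x * wordprod w)%g = size w - j.
Proof.
move=> gw jw; split.
  by rewrite -{1}(vertex0 x w) vertex_dist // subn0.
by rewrite -vertex_size vertex_dist.
Qed.

Lemma geodesic_size x w : geodesic_word S w -> d x (x * wordprod w)%g = size w.
Proof. by move=> gw; rewrite -{1}(vertex0 x w) -vertex_size vertex_dist // subn0. Qed.

(** Walking from x to y, the vertices are first close to the side w3 from z to x
    and in the end close to the side w2; at the change of sides lies a vertex
    that is almost on the way from x to z and from y to z. *)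
Lemma triangle_center N x y z w1 w2 w3 :
    (forall i, i <= size w1 ->
      (exists2 j, j <= size w2 & d (vertex x w1 i) (vertex y w2 j) <= N) \/
      (exists2 j, j <= size w3 & d (vertex x w1 i) (vertex z w3 j) <= N)) ->
    geodesic_word S w1 -> geodesic_word S w2 -> geodesic_word S w3 ->
    (x * wordprod w1 = y)%g -> (y * wordprod w2 = z)%g -> (z * wordprod w3 = x)%g ->
  exists2 i, i <= size w1 &
    i + d (vertex x w1 i) z <= d x z + 2 * N + 2 /\
    (size w1 - i) + d (vertex x w1 i) z <= d y z + 2 * N + 2.
Proof.
move=> thin g1 g2 g3 e1 e2 e3; set p := vertex x w1.
pose A i := exists2 j, j <= size w3 & d (p i) (vertex z w3 j) <= N.
pose B i := exists2 j, j <= size w2 & d (p i) (vertex y w2 j) <= N.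
have AE i : i <= size w1 -> A i -> i + d (p i) z <= d x z + 2 * N.
  move=> iw [j jw dj]; have [p1 _] := geodesic_vertex_between x g1 iw.
  have [q1 q2] := geodesic_vertex_between z g3 jw; rewrite e3 in q2.
  have := geodesic_size z g3; rewrite e3 => sz.
  have := dist_triangle (vertex z w3 j) x (p i).
  have := dist_triangle (vertex z w3 j) (p i) z; have := dist_sym x z.
  have := dist_sym (vertex z w3 j) x; have := dist_sym (vertex z w3 j) z.
  have := dist_sym (vertex z w3 j) (p i); move: p1; rewrite -/(p i); lia.
have BE i : i <= size w1 -> B i -> (size w1 - i) + d (p i) z <= d y z + 2 * N.
  move=> iw [j jw dj]; have [_ p2] := geodesic_vertex_between x g1 iw; rewrite e1 in p2.
  have [q1 q2] := geodesic_vertex_between y g2 jw; rewrite e2 in q2.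
  have := geodesic_size y g2; rewrite e2 => sz.
  have := dist_triangle (vertex y w2 j) (p i) y.
  have := dist_triangle (vertex y w2 j) (p i) z.
  have := dist_sym (vertex y w2 j) y; move: p2; rewrite -/(p i); lia.
have AB i : i <= size w1 -> A i \/ B i by move=> /thin[]; [right | left].
have Bn : B (size w1).
  by exists 0 => //; rewrite /p vertex0 vertex_size e1 /dist mulVg word_length1.
have A0 : A 0.
  by exists (size w3) => //; rewrite /p vertex0 vertex_size e3 /dist mulVg word_length1.
have [allA|] := pselect (forall i, i <= size w1 -> A i).
  exists (size w1) => //; have := AE _ (leqnn _) (allA _ (leqnn _)).
  by have := BE _ (leqnn _) Bn; split; lia.
move=> /existsNP[i0 /not_implyP[i0w nA]].
have [i [iw Ai nAi]] : exists i, [/\ i < size w1, A i & ~ A i.+1].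
  elim: i0 i0w nA => [//|i IH] iw nA.
  by have [Ai|nAi] := pselect (A i); [exists i | apply: IH => //; apply: ltnW].
have Bi : B i.+1 by case: (AB _ iw).
exists i; first exact: ltnW.
have := AE _ (ltnW iw) Ai; have := BE _ iw Bi.
have step : d (p i) (p i.+1) = 1 by rewrite vertex_dist // subSnn.
have := dist_triangle (p i.+1) (p i) z; split; lia.
Qed.

(** Take such vertices on the side from x to y for z and for t. If the one for z
    comes first, then d x t and d y z together traverse the part between them
    twice; otherwise d x z and d y t do. In both cases they exceed, up to the
    error, the length of the side together with the detour from z to t. *)
Lemma thin_four_point N : @thin_triangles G S N ->
  forall x y z t, d x y + d z t <= maxn (d x z + d y t) (d x t + d y z) + (4 * N + 4).
Proof.
move=> thin x y z t; have [w gw e] := geodesic_word_exists genS x y.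
have center c : exists2 i, i <= size w &
    i + d (vertex x w i) c <= d x c + 2 * N + 2 /\
    (size w - i) + d (vertex x w i) c <= d y c + 2 * N + 2.
  have [w2 g2 e2] := geodesic_word_exists genS y c.
  have [w3 g3 e3] := geodesic_word_exists genS c x.
  by apply: (triangle_center _ gw g2 g3 e e2 e3) => i; apply: thin.
have sw := geodesic_size x gw; rewrite e in sw.
have [i iw [i1 i2]] := center z; have [j jw [j1 j2]] := center t.
have dij : d (vertex x w i) (vertex x w j) <= (i - j) + (j - i).
  have [ij|/ltnW ij] := leqP i j; first by rewrite vertex_dist //; lia.
  by rewrite dist_sym vertex_dist //; lia.
have := dist_triangle (vertex x w i) z t.
have := dist_triangle (vertex x w j) (vertex x w i) t.
have := dist_sym z (vertex x w i); lia.
Qed.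
End FourPoint.

Lemma word_hyperbolic_length (R : realType) (G : groupType) :
  word_hyperbolic R G -> exists (l : G -> nat) D, hyperbolic_length l D.
Proof.
move=> [S [finS genS [delta _ /(delta_hyperbolic_thin_triangles genS)[N thin]]]].
exists (word_length S), (4 * N + 4); split.
- exact: word_length1.
- exact: word_lengthV.
- exact: word_lengthM.
- by move=> n; apply: word_length_ball.
- exact: word_length_split.
- exact: thin_four_point.
Qed.

Theorem theoremA (R : realType) (G : groupType) (H : set G) :
  word_hyperbolic R G ->
  subgroup H ->
  finitely_generated H ->
  finite_set (Frattini H).
Proof.
by move=> /word_hyperbolic_length[l [D hyp]] sgH fgH; apply: (finite_Frattini hyp).
Qed.
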